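(* For every fixed integer $f\ge 2$, the min-sum problem (given an instance as described in the context, compute an $\mathcal{A}$-perfect stable matching $M$ minimizing the total cost $\sum_{p\in\mathcal{B}}|M(p)|\cdot c(p)$) is NP-hard, even when restricted to instances in which every agent's preference list has length exactly $f$, there is a master list ordering on agents and a master list ordering on programs (every agent's and every program's preference list is consistent with a single global ordering of the programs, respectively agents), and the costs of programs take only $2$ distinct values.
   Context: An instance consists of a bipartite graph $G=(\mathcal{A}\cup\mathcal{B},E)$, where $\mathcal{A}$ is a set of agents, $\mathcal{B}$ a set of programs, and $(a,p)\in E$ iff $a$ and $p$ are mutually acceptable. Each agent ranks its neighbours in a strict order and each program ranks its neighbours in a strict order; $y>_x z$ means $x$ prefers $y$ to $z$. Each program $p$ has a non-negative integer cost $c(p)$; programs have no quotas. A matching $M\subseteq E$ assigns each agent to at most one program (a program may receive any number of agents); $M(a)$ is the program of $a$ and $M(p)$ the set of agents assigned to $p$. An agent prefers any acceptable program to being unmatched. A pair $(a,p)\in E\setminus M$ blocks $M$ if $p>_a M(a)$ and there is $a'\in M(p)$ with $a>_p a'$; $M$ is stable if no pair blocks it. $M$ is $\mathcal{A}$-perfect if every agent is matched. *)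

(* Defs.v *)
From mathcomp Require Import all_boot.

Set Implicit Arguments.
Unset Strict Implicit.
Unset Printing Implicit Defensive.

(** * Deterministic multi-tape Turing machines *)

Inductive move := Left | Stay | Right.

Section Tapes.
Variable G : Type. (* auxiliary tape symbols *)

(* [None] is the blank, [Some (inl b)] an input/output bit. *)
Definition symbol : Type := option (bool + G).

(* [(l, r)] is a two-way infinite tape: [r] lists the scanned cell and the
   cells to its right, [l] the cells to its left, nearest first.  Cells beyond
   either list are blank. *)
Definition tape : Type := (seq symbol * seq symbol)%type.

Definition tape_read (t : tape) : symbol := head None t.2.

Definition tape_write (s : symbol) (t : tape) : tape := (t.1, s :: behead t.2).

Definition tape_move (m : move) (t : tape) : tape :=
  match m with
  | Left => (behead t.1, head None t.1 :: t.2)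
  | Stay => t
  | Right => (tape_read t :: t.1, behead t.2)
  end.

Definition tape_of_bits (x : seq bool) : tape :=
  ([::], [seq Some (inl b) | b <- x]).

(* The output stops at the first cell that does not hold a bit. *)
Fixpoint bits_of_cells (r : seq symbol) : seq bool :=
  if r is Some (inl b) :: r' then b :: bits_of_cells r' else [::].

End Tapes.

(* [tm_trans] receives the state and the scanned symbols; [None] means halt. *)
Record TM := {
  tm_aux : finType;
  tm_state : finType;
  tm_start : tm_state;
  tm_tape : finType;
  tm_io : tm_tape;
  tm_trans : tm_state -> {ffun tm_tape -> symbol tm_aux} ->
    option (tm_state * (tm_tape -> symbol tm_aux * move))
}.

Section Run.
Variable M : TM.

Definition config : Type := (tm_state M * (tm_tape M -> tape (tm_aux M)))%type.

Definition init_config (x : seq bool) : config :=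
  (tm_start M, fun i => tape_of_bits _ (if i == tm_io M then x else [::])).

Definition step (c : config) : option config :=
  if tm_trans c.1 [ffun i => tape_read (c.2 i)] is Some (q, act) then
    Some (q, fun i => tape_move (act i).2 (tape_write (act i).1 (c.2 i)))
  else None.

Definition halts_with (x : seq bool) (t : nat) (y : seq bool) : Prop :=
  exists c : config,
    [/\ iter t (obind step) (Some (init_config x)) = Some c,
        step c = None
      & bits_of_cells (c.2 (tm_io M)).2 = y].

End Run.

(** * Polynomial time, NP and NP-hardness *)

Definition polytime (f : seq bool -> seq bool) : Prop :=
  exists (M : TM) (k d : nat), forall x : seq bool,
    exists2 t, t <= k * size x ^ d + k & halts_with M x t (f x).

(* Self-delimiting code for lists. *)
Definition encode_seq (T : Type) (enc : T -> seq bool) (s : seq T) : seq bool :=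
  flatten [seq true :: enc x | x <- s] ++ [:: false].

Definition encode_bits : seq bool -> seq bool := encode_seq (fun b => [:: b]).

(* Binary digits, least significant first, without leading zeros. *)
Definition binary (n : nat) : seq bool :=
  mkseq (fun i => odd (n %/ 2 ^ i)) (up_log 2 n.+1).

Definition encode_nat (n : nat) : seq bool := encode_bits (binary n).

(* [w] is the certificate, and [V] is a verifier accepting with output 1. *)
Definition in_NP (L : seq bool -> Prop) : Prop :=
  exists (V : seq bool -> seq bool) (k d : nat), polytime V /\
    forall x : seq bool, L x <->
      exists2 w, size w <= k * size x ^ d + k
               & V (encode_bits x ++ w) = [:: true].

Record min_problem := {
  mp_instance : Type;
  mp_encode : mp_instance -> seq bool;
  mp_solution : mp_instance -> Type;
  mp_feasible : forall I, mp_solution I -> Prop;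
  mp_cost : forall I, mp_solution I -> nat
}.

Definition optimal (P : min_problem) (I : mp_instance P) (s : mp_solution I) :
    Prop :=
  mp_feasible s /\
  forall s' : mp_solution I, mp_feasible s' -> mp_cost s <= mp_cost s'.

(* NP-hardness of a minimization problem is that of its decision version
   "is the optimum at most [K]?", under polynomial-time many-one reductions.
   Every string, member of [L] or not, is sent to an instance in [D]. *)
Definition NP_hard_on (P : min_problem) (D : mp_instance P -> Prop) : Prop :=
  forall L : seq bool -> Prop, in_NP L ->
  exists2 f : seq bool -> seq bool, polytime f &
    forall x : seq bool, exists (I : mp_instance P) (K : nat),
      [/\ f x = mp_encode I ++ encode_nat K,
          D I
        & L x <-> exists2 s : mp_solution I, optimal s & mp_cost s <= K].

(** * The min-sum problem *)

Record instance := {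
  num_agents : nat;
  num_programs : nat;
  edge : 'I_num_agents -> 'I_num_programs -> bool;
  (* neighbours, most preferred first *)
  agent_pref : 'I_num_agents -> seq 'I_num_programs;
  program_pref : 'I_num_programs -> seq 'I_num_agents;
  program_cost : 'I_num_programs -> nat;
  agent_pref_uniq : forall a, uniq (agent_pref a);
  mem_agent_pref : forall a p, (p \in agent_pref a) = edge a p;
  program_pref_uniq : forall p, uniq (program_pref p);
  mem_program_pref : forall p a, (a \in program_pref p) = edge a p
}.

(* [edge] is determined by the preference lists. *)
Definition encode_instance (I : instance) : seq bool :=
  encode_seq (encode_seq encode_nat)
    [seq [seq val p | p <- agent_pref a] | a <- enum 'I_(num_agents I)] ++
  encode_seq (encode_seq encode_nat)
    [seq [seq val a | a <- program_pref p] | p <- enum 'I_(num_programs I)] ++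
  encode_seq encode_nat
    [seq program_cost p | p <- enum 'I_(num_programs I)].

Section Matchings.
Variable I : instance.
Notation agent := 'I_(num_agents I).
Notation program := 'I_(num_programs I).

(* [M a = None] means that [a] is unmatched. *)
Definition assignment : Type := {ffun agent -> option program}.

Definition is_matching (M : assignment) : Prop :=
  forall a p, M a = Some p -> edge a p.

(* On neighbours of [a] (resp. [p]), these are y >_a z and y >_p z. *)
Definition agent_prefers (a : agent) (y z : program) : bool :=
  index y (agent_pref a) < index z (agent_pref a).

Definition program_prefers (p : program) (y z : agent) : bool :=
  index y (program_pref p) < index z (program_pref p).

Definition blocks (M : assignment) (a : agent) (p : program) : Prop :=
  [/\ edge a p, M a <> Some p,
      (if M a is Some q then agent_prefers a p q else true)
    & exists2 a', M a' = Some p & program_prefers p a a'].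

Definition stable (M : assignment) : Prop := forall a p, ~ blocks M a p.

Definition agent_perfect (M : assignment) : Prop := forall a, M a <> None.

Definition total_cost (M : assignment) : nat :=
  \sum_(p : program) #|[set a | M a == Some p]| * program_cost p.

End Matchings.

Definition min_sum : min_problem := {|
  mp_instance := instance;
  mp_encode := encode_instance;
  mp_solution := assignment;
  mp_feasible := fun I M => [/\ is_matching M, agent_perfect M & stable M];
  mp_cost := total_cost
|}.

Definition master_list (T S : finType) (pref : T -> seq S) : Prop :=
  exists2 s : seq S, perm_eq s (enum S) & forall x, subseq (pref x) s.

Definition restricted (f : nat) (I : instance) : Prop :=
  [/\ forall a : 'I_(num_agents I), size (agent_pref a) = f,
      master_list (@agent_pref I),
      master_list (@program_pref I)
    & size (undup (codom (@program_cost I))) = 2].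

(* Main.v *)
Require Import Defs.
From mathcomp Require Import all_boot.
From mathcomp Require Import zify.
From Stdlib Require Import FunctionalExtensionality Classical.

(** Cook-Levin directly into the min-sum problem.  The run of the verifier on
    the input followed by an unknown certificate is a grid of cells (time,
    tape position), the position being relative to the head: the head stays
    and the tapes move.  A cell holds the state, the scanned symbols and the
    symbols at its position, so every requirement on the grid relates at most
    two cells; the border is free, and its influence moves by one cell per
    step without reaching the output.  The pairs (cell, content) are the
    vertices of a conflict graph whose independent sets of size #cells are the
    accepting runs.

    Independent sets are vertex covers, and a vertex cover is a stable matching
    in which agents choose between two programs: vertex [v] prefers the paid
    program [p_v] to the free one, the edge [uv] prefers [p_u] to [p_v], and
    vertices outrank edges, so a vertex on the free program keeps all edges out
    of [p_v].  Lists are padded with paid programs, which are blocked by as many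
    top-ranked guards as there are vertices: if anybody else used the padding,
    all guards would have to leave the free program.

    The encoding of such an instance is the value of an expression built from
    bounded iterations over unary numbers; expressions are compiled to
    multi-stack programs, and these to Turing machines, in polynomial time. *)

Set Implicit Arguments.
Unset Strict Implicit.
Unset Printing Implicit Defensive.

(** * Stack programs and Turing machines *)

Definition upd (T : Type) (s : nat -> T) (r : nat) (x : T) : nat -> T :=
  fun r' => if r' == r then x else s r'.

Definition store : Type := nat -> seq bool.

(* [Loop r c1 c2] pops register [r] until it is empty, running [c1] or [c2]
   according to the popped bit; [Test] does this at most once. *)
Inductive cmd :=
| Skip
| Push of nat & bool
| Seq of cmd & cmd
| Loop of nat & cmd & cmd
| Test of nat & cmd & cmd & cmd.

(** The step count is that of the compiled machine: a push costs two, since the head moves left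
    before the bit is written, every test of a register costs one, and sequencing costs nothing. *)
Inductive exec : cmd -> store -> nat -> store -> Prop :=
| exec_skip s : exec Skip s 1 s
| exec_push r b s : exec (Push r b) s 2 (upd s r (b :: s r))
| exec_seq c1 c2 s1 s2 s3 n1 n2 :
    exec c1 s1 n1 s2 -> exec c2 s2 n2 s3 -> exec (Seq c1 c2) s1 (n1 + n2) s3
| exec_loop0 r c1 c2 s : s r = [::] -> exec (Loop r c1 c2) s 1 s
| exec_loop r c1 c2 s1 s2 s3 n1 n2 b l :
    s1 r = b :: l -> exec (if b then c1 else c2) (upd s1 r l) n1 s2 ->
    exec (Loop r c1 c2) s2 n2 s3 -> exec (Loop r c1 c2) s1 (n1 + n2).+1 s3
| exec_test0 r c0 c1 c2 s s' n :
    s r = [::] -> exec c0 s n s' -> exec (Test r c0 c1 c2) s n.+1 s'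
| exec_test r c0 c1 c2 s s' n b l :
    s r = b :: l -> exec (if b then c1 else c2) (upd s r l) n s' ->
    exec (Test r c0 c1 c2) s n.+1 s'.

Notation sym := (symbol void).

(** The extra state [None] of a loop or a test is the one that inspects the register. *)
Fixpoint state (c : cmd) : finType :=
  match c with
  | Skip => unit
  | Push _ _ => bool
  | Seq c1 c2 => (state c1 + state c2)%type
  | Loop _ c1 c2 => option (state c1 + state c2)
  | Test _ c0 c1 c2 => option (state c0 + (state c1 + state c2))
  end.

Fixpoint start (c : cmd) : state c :=
  match c with
  | Skip => tt
  | Push _ _ => false
  | Seq c1 c2 => inl (start c1)
  | Loop _ c1 c2 => None
  | Test _ c0 c1 c2 => None
  end.

(** An operation touches one register only: it writes the given bit, or rewrites what was read if
    there is none, and then moves. *)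
Definition op : Type := option (nat * option bool * move).

Definition act (o : op) (rd : nat -> sym) (i : nat) : sym * move :=
  if o is Some (r, w, m) then
    if i == r then (if w is Some b then Some (inl b) else rd i, m)
    else (rd i, Stay)
  else (rd i, Stay).

(* The successor state [None] means that the command has terminated. *)
Fixpoint trans (c : cmd) : state c -> (nat -> sym) -> option (state c) * op :=
  match c return state c -> (nat -> sym) -> option (state c) * op with
  | Skip => fun _ _ => (None, None)
  | Push r b => fun s _ =>
      if s then (None, Some (r, Some b, Stay))
      else (Some true, Some (r, None, Left))
  | Seq c1 c2 => fun s rd =>
      match s with
      | inl s1 => let: (o, a) := trans s1 rd in
          (if o is Some s' then Some (inl s') else Some (inr (start c2)), a)
      | inr s2 => let: (o, a) := trans s2 rd in
          (if o is Some s' then Some (inr s') else None, a)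
      end
  | Loop r c1 c2 => fun s rd =>
      match s with
      | None =>
          match rd r with
          | Some (inl true) =>
              (Some (Some (inl (start c1))), Some (r, None, Right))
          | Some (inl false) =>
              (Some (Some (inr (start c2))), Some (r, None, Right))
          | _ => (None, None)
          end
      | Some (inl s1) => let: (o, a) := trans s1 rd in
          (if o is Some s' then Some (Some (inl s')) else Some None, a)
      | Some (inr s2) => let: (o, a) := trans s2 rd in
          (if o is Some s' then Some (Some (inr s')) else Some None, a)
      end
  | Test r c0 c1 c2 => fun s rd =>
      match s with
      | None =>
          match rd r with
          | Some (inl true) =>
              (Some (Some (inr (inl (start c1)))), Some (r, None, Right))
          | Some (inl false) =>
              (Some (Some (inr (inr (start c2)))), Some (r, None, Right))
          | _ => (Some (Some (inl (start c0))), None)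
          end
      | Some (inl s0) => let: (o, a) := trans s0 rd in
          (if o is Some s' then Some (Some (inl s')) else None, a)
      | Some (inr (inl s1)) => let: (o, a) := trans s1 rd in
          (if o is Some s' then Some (Some (inr (inl s'))) else None, a)
      | Some (inr (inr s2)) => let: (o, a) := trans s2 rd in
          (if o is Some s' then Some (Some (inr (inr s'))) else None, a)
      end
  end.

Fixpoint tested (c : cmd) : nat :=
  match c with
  | Skip | Push _ _ => 0
  | Seq c1 c2 => maxn (tested c1) (tested c2)
  | Loop r c1 c2 => maxn r (maxn (tested c1) (tested c2))
  | Test r c0 c1 c2 => maxn r (maxn (tested c0) (maxn (tested c1) (tested c2)))
  end.

(** * Simulation of stack programs on tapes *)

Section Compile.
Variable m : nat.
Notation tapes := ('I_m.+1 -> tape void).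

Definition reads (tp : tapes) (r : nat) : sym := tape_read (tp (inord r)).

Definition apply (o : op) (tp : tapes) : tapes := fun i =>
  tape_move (act o (reads tp) i).2 (tape_write (act o (reads tp) i).1 (tp i)).

Inductive reach (c : cmd) : state c -> tapes -> nat -> tapes -> Prop :=
| reach_exit s tp : (trans s (reads tp)).1 = None ->
    reach s tp 1 (apply (trans s (reads tp)).2 tp)
| reach_step s s' tp tp' n : (trans s (reads tp)).1 = Some s' ->
    reach s' (apply (trans s (reads tp)).2 tp) n tp' -> reach s tp n.+1 tp'.

Definition continue c (k : option (state c)) tp n tp' : Prop :=
  if k is Some u then reach u tp n tp' else n = 0 /\ tp' = tp.

(** The transition on which the subcommand would exit leads directly to [k] in the compound command,
    so embedding a run costs no additional step. *)
Lemma reach_embed c c1 (phi : state c1 -> state c) k s tp n tp' n' tp'' :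
  (forall s rd, trans (phi s) rd =
     (if (trans s rd).1 is Some s' then Some (phi s') else k, (trans s rd).2)) ->
  reach s tp n tp' -> continue k tp' n' tp'' -> reach (phi s) tp (n + n') tp''.
Proof.
move=> phiE; elim=> {s tp n tp'} [s tp|s s' tp tp' n] trE.
  have := phiE s (reads tp); rewrite trE => E.
  have E1 := congr1 fst E; have E2 := congr1 snd E; rewrite /= in E1 E2.
  rewrite -E2; case: k phiE E E1 => [u|] _ _ E1 /=.
    by rewrite add1n => kP; apply: reach_step E1 _.
  by move=> [-> ->]; rewrite addn0; apply: reach_exit.
move=> _ IH /IH {}IH; have := phiE s (reads tp); rewrite trE => E.
have E1 := congr1 fst E; have E2 := congr1 snd E; rewrite /= in E1 E2.
by rewrite addSn; apply: reach_step E1 _; rewrite E2.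
Qed.

(** The top of a stack is under the head and the rest to its right. Comparison through [nth] ignores
    trailing blanks, and the cells to the left, which hold popped bits, are arbitrary. *)
Definition rep (s : store) (tp : tapes) : Prop :=
  forall i j, nth None (tp i).2 j = nth None [seq Some (inl b) | b <- s i] j.

Lemma reads_rep s tp r : r <= m -> rep s tp ->
  reads tp r = if s r is b :: _ then Some (inl b) else None.
Proof.
move=> rm /(_ (inord r) 0); rewrite /reads /tape_read nth0 inordK // => ->.
by case: (s r).
Qed.

(** Writing back the scanned symbol may turn an empty list into a single blank, which [nth] does not
    see. *)
Lemma nth_rewrite (t : tape void) j :
  nth None (tape_write (tape_read t) t).2 j = nth None t.2 j.
Proof. by case: t => l [|a r] //=; case: j => [|j] //=; rewrite nth_nil. Qed.

Lemma reads_val (tp : tapes) (i : 'I_m.+1) : reads tp i = tape_read (tp i).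
Proof. by rewrite /reads inord_val. Qed.

Lemma rep_nop s tp : rep s tp -> rep s (apply None tp).
Proof. by move=> sP i j; rewrite /apply /= reads_val nth_rewrite. Qed.

Lemma rep_pop s tp r b l : s r = b :: l -> rep s tp ->
  rep (upd s r l) (apply (Some (r, None, Right)) tp).
Proof.
move=> srE sP i j; rewrite /apply /act /upd; case: eqP => [ir|_] /=.
  by have := sP i j.+1; rewrite ir srE /= => <-; case: (tp i).2 => //=; rewrite !nth_nil.
by rewrite reads_val nth_rewrite.
Qed.

(** The cell entered on the left may hold a popped bit, which the second step overwrites. *)
Lemma rep_push s tp r b : rep s tp ->
  rep (upd s r (b :: s r))
    (apply (Some (r, Some b, Stay)) (apply (Some (r, None, Left)) tp)).
Proof.
move=> sP i j; rewrite /apply /act /upd; case: eqP => [ir|/eqP ir] /=.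
  by case: j => //= j; rewrite ?reads_val nth_rewrite sP ir.
rewrite reads_val (negPf ir) /= reads_val.
by rewrite -[LHS]/(nth None (tape_write (tape_read (tp i)) (tp i)).2 j) nth_rewrite sP.
Qed.

(** A register beyond [m] has no tape: pushing on it changes nothing, which is sound because it is
    never tested and [rep] does not speak of it. *)
Lemma exec_reach c s n s' tp : exec c s n s' -> tested c <= m -> rep s tp ->
  exists2 tp', reach (start c) tp n tp' & rep s' tp'.
Proof.
move=> E; elim: E tp => {c s n s'}.
- move=> s tp _ sP; exists (apply None tp); last exact: rep_nop.
  exact: (@reach_exit Skip).
- move=> r b s tp _ sP; eexists; last exact: rep_push sP.
  by apply: (@reach_step (Push r b) false true) => //=; apply: (@reach_exit (Push r b) true).
- move=> c1 c2 s1 s2 s3 n1 n2 _ IH1 _ IH2 tp /=; rewrite geq_max => /andP[m1 m2] sP.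
  have [tp' R1 /(IH2 _ m2)[tp'' R2 P2]] := IH1 _ m1 sP.
  exists tp'' => //; apply: (@reach_embed (Seq c1 c2) c1 inl (Some (inr (start c2)))) R1 _.
    by move=> s rd /=; case: (trans s rd) => [[]].
  rewrite /= -[n2]addn0; apply: (@reach_embed (Seq c1 c2) c2 inr None) R2 _ => //.
  by move=> s rd /=; case: (trans s rd) => [[]].
- move=> r c1 c2 s sr tp /=; rewrite geq_max => /andP[rm _] sP.
  exists (apply None tp); last exact: rep_nop.
  have := @reach_exit (Loop r c1 c2) None tp.
  by rewrite /= (reads_rep rm sP) sr; apply.
- move=> r c1 c2 s1 s2 s3 n1 n2 b l sr _ IH1 _ IH2 tp /= mm sP.
  have := mm; rewrite 2!geq_max => /and3P[rm m1 m2].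
  have mb : tested (if b then c1 else c2) <= m by case: (b).
  have [tp' R1 /(IH2 _ mm)[tp'' R2 P2]] := IH1 _ mb (rep_pop sr sP).
  exists tp'' => //; have rdE := reads_rep rm sP; rewrite sr in rdE.
  case: b {sr mb sP IH1} rdE R1 => rdE R1.
  + apply: (@reach_step (Loop r c1 c2) None (Some (inl (start c1)))); rewrite /= rdE //.
    apply: (@reach_embed (Loop r c1 c2) c1 (Some \o inl) (Some None)) R1 R2.
    by move=> s rd /=; case: (trans s rd) => [[]].
  + apply: (@reach_step (Loop r c1 c2) None (Some (inr (start c2)))); rewrite /= rdE //.
    apply: (@reach_embed (Loop r c1 c2) c2 (Some \o inr) (Some None)) R1 R2.
    by move=> s rd /=; case: (trans s rd) => [[]].
- move=> r c0 c1 c2 s s' n sr _ IH tp /=; rewrite geq_max => /andP[rm].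
  rewrite geq_max => /andP[m0 _] sP.
  have [tp' R P] := IH _ m0 (rep_nop sP); exists tp' => //.
  apply: (@reach_step (Test r c0 c1 c2) None (Some (inl (start c0))));
    rewrite /= (reads_rep rm sP) sr //= -[n]addn0.
  apply: (@reach_embed (Test r c0 c1 c2) c0 (Some \o inl) None) R _ => //.
  by move=> u rd /=; case: (trans u rd) => [[]].
- move=> r c0 c1 c2 s s' n b l sr _ IH tp /=.
  rewrite !geq_max => /and4P[rm _ m1 m2] sP.
  have mb : tested (if b then c1 else c2) <= m by case: (b).
  have [tp' R P] := IH _ mb (rep_pop sr sP); exists tp' => //.
  have rdE := reads_rep rm sP; rewrite sr in rdE.
  case: b {sr mb sP IH} rdE R => rdE R.
  + apply: (@reach_step (Test r c0 c1 c2) None (Some (inr (inl (start c1)))));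
      rewrite /= rdE // -[n]addn0.
    apply: (@reach_embed (Test r c0 c1 c2) c1 (fun u => Some (inr (inl u))) None) R _ => //.
    by move=> u rd /=; case: (trans u rd) => [[]].
  + apply: (@reach_step (Test r c0 c1 c2) None (Some (inr (inr (start c2)))));
      rewrite /= rdE // -[n]addn0.
    apply: (@reach_embed (Test r c0 c1 c2) c2 (fun u => Some (inr (inr u))) None) R _ => //.
    by move=> u rd /=; case: (trans u rd) => [[]].
Qed.

End Compile.

(** The state [None] is the halting one, and register 0 carries input and output. *)
Definition machine (c : cmd) : TM := {|
  tm_aux := void;
  tm_state := option (state c);
  tm_start := Some (start c);
  tm_tape := 'I_(tested c).+1;
  tm_io := ord0;
  tm_trans := fun q g =>
    if q is Some s then
      let: (o, a) := trans s (fun r => g (inord r)) in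
      Some (o, fun i : 'I_(tested c).+1 => act a (fun r => g (inord r)) i)
    else None
|}.

Lemma reach_machine c (s : state c) (tp tp' : 'I_(tested c).+1 -> tape void) n :
  reach s tp n tp' ->
  iter n (obind (@step (machine c))) (Some (Some s, tp)) = Some (None, tp').
Proof.
have stepE (s0 : state c) (tp0 : 'I_(tested c).+1 -> tape void) :
    @step (machine c) (Some s0, tp0) =
    Some ((trans s0 (reads tp0)).1, apply (trans s0 (reads tp0)).2 tp0).
  rewrite /step /= (_ : (fun r => _) = reads tp0); last first.
    by apply: functional_extensionality => r; rewrite ffunE.
  by case: (trans s0 _).
elim=> {s tp n tp'} [s tp E|s s' tp tp' n E _ IH]; first by rewrite /= stepE E.
by rewrite iterSr [obind _ _]stepE E IH.
Qed.

Lemma exec_polytime c (f : seq bool -> seq bool) k d :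
  (forall x, exists n s', [/\ n <= k * size x ^ d + k,
     exec c (upd (fun=> [::]) 0 x) n s' & s' 0 = f x]) ->
  polytime f.
Proof.
move=> cP; exists (machine c), k, d => x; have [n [s' [nle E s'E]]] := cP x.
exists n => //; pose tp := (@init_config (machine c) x).2.
have [|tp' R P] := @exec_reach (tested c) _ _ _ _ tp E (leqnn _).
  move=> i j; rewrite /tp /= /upd -(inj_eq val_inj) /=.
  by case: eqP => //=; rewrite nth_nil.
exists (None, tp'); split => //; first exact: (reach_machine R).
(* Agreement cell by cell, including the blank after the last bit, makes the output stop where the
   register ends. *)
have := P ord0; rewrite /= s'E; elim: (f x) (tp' ord0).2 => [|b l IH] [|a r] //= rE.
- by move: (rE 0) => /= ->.
- by have := rE 0.
by move: (rE 0) => /= ->; rewrite (IH r) // => j; exact: (rE j.+1).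
Qed.

(** * Expressions computable in polynomial time *)

(** The base [N + 2] is at least 2, so constants and sums are absorbed by a larger exponent and no
    coefficients occur. *)
Definition poly_bounded (q : nat -> nat) : Prop :=
  exists C, forall N, q N <= (N + 2) ^ C.

Lemma poly_const c : poly_bounded (fun=> c).
Proof.
exists c => N; apply: leq_trans (ltnW (ltn_expl c (ltnSn 1))) _.
by case: c => // c; rewrite leq_exp2r //; lia.
Qed.

Lemma poly_id : poly_bounded id.
Proof. by exists 1 => N; lia. Qed.

Lemma poly_mul q1 q2 : poly_bounded q1 -> poly_bounded q2 ->
  poly_bounded (fun N => q1 N * q2 N).
Proof.
by move=> [C1 P1] [C2 P2]; exists (C1 + C2) => N; rewrite expnD leq_mul.
Qed.

Lemma poly_add q1 q2 : poly_bounded q1 -> poly_bounded q2 ->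
  poly_bounded (fun N => q1 N + q2 N).
Proof.
move=> [C1 P1] [C2 P2]; exists (C1 + C2).+1 => N.
have p1 : 0 < (N + 2) ^ C1 by rewrite expn_gt0; lia.
have p2 : 0 < (N + 2) ^ C2 by rewrite expn_gt0; lia.
have p12 : (N + 2) ^ C1 + (N + 2) ^ C2 <= 2 * ((N + 2) ^ C1 * (N + 2) ^ C2) by nia.
rewrite expnS expnD; apply: leq_trans (leq_add (P1 N) (P2 N)) _.
by apply: leq_trans p12 _; rewrite leq_mul2r; lia.
Qed.

Lemma poly_comp q1 q2 : poly_bounded q1 -> poly_bounded q2 ->
  poly_bounded (fun N => q1 (q2 N)).
Proof.
move=> [C1 P1] [C2 P2]; exists (C2.+2 * C1) => N.
apply: leq_trans (P1 _) _; rewrite expnM; case: C1 {P1} => [|C1] //.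
rewrite leq_exp2r //.
have p2 : 0 < (N + 2) ^ C2 by rewrite expn_gt0; lia.
have le4 : 2 * (N + 2) ^ C2 <= (N + 2) * (N + 2) ^ C2 by rewrite leq_mul2r; lia.
rewrite !expnS; have := P2 N; nia.
Qed.

(** * Moving and clearing registers *)

Definition move_reg a b := Loop a (Push b true) (Push b false).
Definition clear_reg a := Loop a Skip Skip.

Ltac upd_eq :=
  rewrite /upd ?eqxx;
  repeat match goal with |- context [?a == ?b] => destruct (@eqP _ a b) end;
  subst; simpl; try congruence; try lia.

Ltac store_eq :=
  let i := fresh "i" in apply: functional_extensionality => i; upd_eq.

Lemma exec_ext c s n s' s'' n' :
  exec c s n s' -> s' = s'' -> n = n' -> exec c s n' s''.
Proof. by move=> E <- <-. Qed.

(** Popping from one stack and pushing on another reverses the contents; later programs use this to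
    restore the order of a result. *)
Lemma exec_move a b s : a <> b ->
  exec (move_reg a b) s (3 * size (s a)).+1
    (upd (upd s a [::]) b (rev (s a) ++ s b)).
Proof.
move=> ab; move El: (s a) => l; elim: l s El => [|x l IH] s sa.
  by apply: exec_ext (exec_loop0 _ _ sa) _ _ => //; store_eq.
apply: exec_ext (exec_loop (n1 := 2) sa _ (IH (upd (upd s a l) b (x :: s b)) _)) _ _.
- case: x {sa} => /=; apply: exec_ext (exec_push _ _ _) _ _ => //; store_eq.
- by rewrite /upd; case: eqP => // _; rewrite eqxx.
- apply: functional_extensionality => i; rewrite /upd rev_cons cat_rcons eqxx.
  by repeat (case: eqP => ? //).
- by rewrite /=; lia.
Qed.

Lemma exec_clear a s :
  exec (clear_reg a) s (2 * size (s a)).+1 (upd s a [::]).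
Proof.
move El: (s a) => l; elim: l s El => [|x l IH] s sa.
  by apply: exec_ext (exec_loop0 _ _ sa) _ _ => //; store_eq.
apply: exec_ext (exec_loop (n1 := 1) sa _ (IH (upd s a l) _)) _ _.
- by case: x {sa}; apply: exec_skip.
- by rewrite /upd eqxx.
- store_eq.
- by rewrite /=; lia.
Qed.

(* String-valued expressions over named string variables.  A natural number is
   represented by any string of that length. *)
Inductive exp :=
| Empty
| Lit of bool
| Var of nat
| Cat of exp & exp
| For of nat & exp & exp
| Drop of exp & exp
| Case of exp & exp & exp & exp.

Fixpoint eval (env : nat -> seq bool) (e : exp) : seq bool :=
  match e with
  | Empty => [::]
  | Lit b => [:: b]
  | Var v => env v
  | Cat e1 e2 => eval env e1 ++ eval env e2
  | For v e1 e2 =>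
      flatten [seq eval (upd env v (nseq i true)) e2
              | i <- iota 0 (size (eval env e1))]
  | Drop e1 e2 => drop (size (eval env e1)) (eval env e2)
  | Case e e0 e1 e2 =>
      match eval env e with
      | [::] => eval env e0
      | b :: _ => eval env (if b then e1 else e2)
      end
  end.

(* [compile e rho k d] puts the reversal of [e] on top of register [d]; the
   variable [v] is in register [rho v], and all registers from [k] on are
   available and empty. *)
Fixpoint compile (e : exp) (rho : nat -> nat) (k d : nat) : cmd :=
  match e with
  | Empty => Skip
  | Lit b => Push d b
  | Var v =>
      Seq (Loop (rho v) (Seq (Push k true) (Push d true))
                        (Seq (Push k false) (Push d false)))
          (move_reg k (rho v))
  | Cat e1 e2 => Seq (compile e1 rho k d) (compile e2 rho k d)
  | For v e1 e2 =>
      let c := Seq (compile e2 (upd rho v k.+1) k.+2 d) (Push k.+1 true) in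
      Seq (compile e1 rho k.+1 k) (Seq (Loop k c c) (clear_reg k.+1))
  | Drop e1 e2 =>
      let c := Test k.+2 Skip Skip Skip in
      Seq (compile e1 rho k.+1 k) (Seq (compile e2 rho k.+2 k.+1)
        (Seq (move_reg k.+1 k.+2) (Seq (Loop k c c) (move_reg k.+2 d))))
  | Case e e0 e1 e2 =>
      Seq (compile e rho k.+1 k) (Seq (move_reg k k.+1)
        (Test k.+1 (compile e0 rho k d)
          (Seq (clear_reg k.+1) (compile e1 rho k d))
          (Seq (clear_reg k.+1) (compile e2 rho k d))))
  end.

(** * Correctness and running time of compiled expressions *)

Definition represents (env : nat -> seq bool) (N : nat) (rho : nat -> nat)
    (k d : nat) (s : store) : Prop :=
  [/\ d < k, forall v, rho v < k /\ rho v <> d, forall v, s (rho v) = env v,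
      forall r, k <= r -> s r = [::] & forall v, size (env v) <= N].

Definition compile_spec (e : exp) (q : nat -> nat) : Prop :=
  forall env N rho k d s, represents env N rho k d s ->
    size (eval env e) <= q N /\
    exists2 n, n <= q N &
      exec (compile e rho k d) s n (upd s d (rev (eval env e) ++ s d)).

(** Reading a register empties it, so its bits are copied to [d] and to the scratch register [k];
    moving [k] back undoes the reversal. *)
Lemma compile_var v : exists2 q, poly_bounded q & compile_spec (Var v) q.
Proof.
exists (fun N => 8 * N + 2).
  by apply: poly_add; [apply: poly_mul|]; (apply: poly_const || apply: poly_id).
move=> env N rho k d s [dk rhoP sP s0 eN]; split; first by rewrite /=; have := eN v; lia.
have [rk rd] := rhoP v.
exists ((5 * size (env v)).+1 + (3 * size (env v)).+1); first by have := eN v; lia.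
have L : forall l s0, s0 (rho v) = l ->
    exec (Loop (rho v) (Seq (Push k true) (Push d true))
       (Seq (Push k false) (Push d false))) s0 (5 * size l).+1
      (upd (upd (upd s0 (rho v) [::]) k (rev l ++ s0 k)) d (rev l ++ s0 d)).
  elim=> [|x l IH] s1 s1E.
    by apply: exec_ext (exec_loop0 _ _ s1E) _ _ => //; store_eq.
  apply: exec_ext (exec_loop (n1 := 4) s1E _
    (IH (upd (upd (upd s1 (rho v) l) k (x :: s1 k)) d (x :: s1 d)) _)) _ _.
  - have := exec_seq (exec_push k x (upd s1 (rho v) l)) (exec_push d x _) => E1.
    by case: x {s1E} E1 => E1; apply: exec_ext E1 _ _ => //; store_eq.
  - by rewrite /upd; do 2 (case: eqP => [?|_]; first by [congruence|lia]); rewrite eqxx.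
  - apply: functional_extensionality => i; rewrite /upd rev_cons !cat_rcons.
    by rewrite !eqxx; repeat (case: eqP => ? //); lia.
  - by rewrite /=; lia.
have kr : k <> rho v by lia.
have := exec_seq (L _ _ (sP v)) (exec_move _ kr) => /= E.
have nE : (upd (upd (upd s (rho v) [::]) k (rev (env v) ++ s k)) d
        (rev (env v) ++ s d)) k = rev (env v).
  by rewrite /upd eqxx (s0 k) ?cats0 //; case: eqP => //; lia.
rewrite nE size_rev revK in E; apply: exec_ext E _ erefl.
apply: functional_extensionality => i; rewrite /upd !eqxx.
repeat (case: eqP => ? //); subst; try lia.
- by rewrite cats0.
- by rewrite s0.
Qed.

Ltac poly_tac :=
  repeat first [exact: poly_id | exact: poly_const | assumption
               | apply: poly_add | apply: poly_mul | apply: poly_comp].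

Lemma compile_cat e1 e2 q1 q2 :
  compile_spec e1 q1 -> compile_spec e2 q2 ->
  compile_spec (Cat e1 e2) (fun N => q1 N + q2 N).
Proof.
move=> P1 P2 env N rho k d s R; have [dk rhoP sP s0 eN] := R.
have [z1 [n1 l1 E1]] := P1 _ _ _ _ _ _ R.
have [|z2 [n2 l2 E2]] := P2 env N rho k d (upd s d (rev (eval env e1) ++ s d)).
  split=> // [v|r kr]; rewrite /upd; case: eqP => rd.
  - by have [] := rhoP v.
  - exact: sP.
  - lia.
  - exact: s0.
split; first by rewrite /= size_cat leq_add.
exists (n1 + n2); first exact: leq_add.
apply: exec_ext (exec_seq E1 E2) _ erefl.
by store_eq; rewrite rev_cat catA.
Qed.

(** Intermediate values go to the first free register, which is empty, so that nothing lies below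
    them. *)
Lemma compile_temp e q : compile_spec e q ->
  forall env N rho k d s, represents env N rho k d s ->
  size (eval env e) <= q N /\ exists2 n, n <= q N &
    exec (compile e rho k.+1 k) s n (upd s k (rev (eval env e))).
Proof.
move=> P env N rho k d s [dk rhoP sP s0 eN].
have [|z [n l E]] := P env N rho k.+1 k s.
  split=> // [v|r kr]; last by apply: s0; lia.
  by have [] := rhoP v; lia.
by split=> //; exists n => //; rewrite s0 // cats0 in E.
Qed.

(** The length of register [k] counts the remaining rounds, and [k.+1] holds the loop variable in
    unary. This variable can be as long as the range, hence the body is bounded at [N + q1 N]. *)
Lemma compile_for v e1 e2 q1 q2 :
  compile_spec e1 q1 -> compile_spec e2 q2 ->
  compile_spec (For v e1 e2)
    (fun N => q1 N * (q2 (N + q1 N) + 5) + q1 N + 2).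
Proof.
move=> P1 P2 env N rho k d s R; have [dk rhoP sP s0 eN] := R.
have [z1 [n1 l1 E1]] := compile_temp P1 R.
set c := Seq (compile e2 (upd rho v k.+1) k.+2 d) (Push k.+1 true).
pose F i := eval (upd env v (nseq i true)) e2.
pose N' := N + q1 N.
(* Loop invariant: with counter [i] and the rest [l] of the range still to come, the remaining
   rounds put their reversed output on top of [D]. *)
have inner l i D : i + size l <= q1 N ->
    let S j l' D' := upd (upd (upd s k l') k.+1 (nseq j true)) d D' in
    let out := flatten [seq F j | j <- iota i (size l)] in
    size out <= size l * q2 N' /\
    exists2 n, n <= size l * (q2 N' + 3) + 1 &
      exec (Loop k c c) (S i l D) n (S (i + size l) [::] (rev out ++ D)).
  elim: l i D => [|x l IH] i D il S /=.
    split=> //; exists 1 => //; rewrite addn0; apply: exec_loop0.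
    by rewrite /S /upd eqxx; do 2 (case: eqP => ?; first lia).
  have [|z2 [n2 l2 E2]] := P2 (upd env v (nseq i true)) N' (upd rho v k.+1) k.+2 d
      (S i l D).
    rewrite /S /N'; split=> [|u|u|r kr|u]; rewrite /upd; first by lia.
    - by have := rhoP u; case: eqP => ?; lia.
    - case: (u =P v) => _; first by rewrite eqxx; case: eqP => ?; [lia|].
      by have := rhoP u; do 3 (case: eqP => ?; first lia).
    - by do 3 (case: eqP => ?; first lia); apply: s0; lia.
    - by case: eqP => _; [rewrite size_nseq; move: il => /=; lia|have := eN u; lia].
  have [|z3 [n3 l3 E3]] := IH i.+1 (rev (F i) ++ D); first by move: il => /=; lia.
  split; first by rewrite size_cat mulSn leq_add.
  exists (n2 + 2 + n3).+1; first by rewrite mulSn; lia.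
  apply: exec_ext (exec_loop (n1 := n2 + 2) (s2 := S i.+1 l (rev (F i) ++ D))
     (b := x) (l := l) _ _ E3) _ erefl.
  - by rewrite /S /upd eqxx; do 2 (case: eqP => ?; first lia).
  - rewrite (_ : (if x then c else c) = c); last by case: (x).
    rewrite (_ : upd (S i (x :: l) D) k l = S i l D); last by rewrite /S; store_eq.
    apply: exec_ext (exec_seq E2 (exec_push k.+1 true _)) _ erefl.
    by rewrite /S; store_eq.
  - by rewrite addnS rev_cat catA.
have [z2 [n2 l2 E2]] := inner (rev (eval env e1)) 0 (s d) ltac:(by rewrite size_rev).
rewrite size_rev add0n in z2 l2 E2.
have le12 : size (eval env e1) * (q2 N' + 3) <= q1 N * (q2 N' + 3) by rewrite leq_mul2r z1 orbT.
have le12' : size (eval env e1) * q2 N' <= q1 N * q2 N' by rewrite leq_mul2r z1 orbT.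
split; first by rewrite -/N' /=; apply: leq_trans z2 _; rewrite mulnDr; lia.
set s1 := (X in exec _ X _ _) in E2.
have s1E : s1 = upd s k (rev (eval env e1)).
  by rewrite /s1; store_eq; rewrite s0.
rewrite s1E in E2.
set s2 := (X in exec _ _ _ X) in E2.
have s2E : s2 k.+1 = nseq (size (eval env e1)) true.
  by rewrite /s2 /upd eqxx; case: eqP => // ?; lia.
have E3 := exec_seq E1 (exec_seq E2 (exec_clear k.+1 _)).
eexists; last apply: (exec_ext E3 _ erefl).
  by rewrite s2E size_nseq -/N'; rewrite mulnDr in le12 *; lia.
by rewrite /s2; store_eq; first [done | by rewrite s0].
Qed.

(** The value of [e2] is moved once so that its first bit is on top; each bit of [e1] then deletes
    at most one bit, and the last move leaves the remainder reversed on [d]. *)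
Lemma compile_drop e1 e2 q1 q2 :
  compile_spec e1 q1 -> compile_spec e2 q2 ->
  compile_spec (Drop e1 e2) (fun N => 4 * q1 N + 7 * q2 N + 10).
Proof.
move=> P1 P2 env N rho k d s R; have [dk rhoP sP s0 eN] := R.
have [z1 [n1 l1 E1]] := compile_temp P1 R.
have [|z2 [n2 l2 E2]] := @compile_temp _ _ P2 env N rho k.+1 d
    (upd s k (rev (eval env e1))).
  split=> // [|v|v|r kr]; rewrite /upd; first by lia.
  - by have [] := rhoP v; lia.
  - by case: eqP => [?|_]; [have := rhoP v; lia|].
  - case: eqP => [?|_]; [by lia|by apply: s0; lia].
split; first by rewrite /= size_drop; lia.
have nk : k.+1 <> k.+2 by lia.
have nd : k.+2 <> d by lia.
set c := Test k.+2 Skip Skip Skip.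
have L l u s1 : s1 k = l -> s1 k.+2 = u -> exists2 n, n <= 3 * size l + 1 &
    exec (Loop k c c) s1 n (upd (upd s1 k [::]) k.+2 (drop (size l) u)).
  elim: l u s1 => [|x l IH] u s1 lE uE.
    exists 1 => //; apply: exec_ext (exec_loop0 _ _ lE) _ erefl.
    by store_eq; rewrite drop0.
  have [|//|n ln E] := IH (behead u) (upd (upd s1 k l) k.+2 (behead u)).
  - by rewrite /upd eqxx; case: eqP => // ?; lia.
  - by rewrite /upd eqxx.
  exists (2 + n).+1; first by rewrite /=; lia.
  apply: exec_ext (exec_loop (n1 := 2) lE _ E) _ erefl.
  - rewrite (_ : (if x then c else c) = c); last by case: x {lE}.
    case: u uE {E} => [|b u] uE.
      apply: exec_ext (exec_test0 _ _ _ (exec_skip _)) _ erefl.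
        by rewrite /upd; case: eqP => // ?; lia.
      by store_eq.
    apply: (@exec_test _ _ _ _ _ _ 1 b u).
      by rewrite /upd; case: eqP => ?; [lia|].
    by case: b {uE} => /=; exact: exec_skip.
  - by store_eq; rewrite -drop1 drop_drop addn1.
have [||n3 l3 E3] := L (rev (eval env e1)) (eval env e2)
  (upd (upd (upd (upd s k (rev (eval env e1))) k.+1 (rev (eval env e2))) k.+1 [::]) k.+2
    (eval env e2)).
- by upd_eq.
- by rewrite /upd eqxx.
rewrite size_rev in l3 E3.
have M1 := exec_move (upd (upd s k (rev (eval env e1))) k.+1 (rev (eval env e2))) nk.
have A1 : upd (upd s k (rev (eval env e1))) k.+1 (rev (eval env e2)) k.+1
  = rev (eval env e2) by rewrite /upd eqxx.
have A2 : upd (upd s k (rev (eval env e1))) k.+1 (rev (eval env e2)) k.+2 = [::].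
  by upd_eq; apply: s0; lia.
rewrite A1 A2 revK cats0 size_rev in M1.
have M2 := exec_move (upd (upd (upd (upd (upd (upd s k (rev (eval env e1))) k.+1
  (rev (eval env e2))) k.+1 [::]) k.+2 (eval env e2)) k [::]) k.+2
  (drop (size (eval env e1)) (eval env e2))) nd.
eexists; last apply: (exec_ext (exec_seq E1 (exec_seq E2 (exec_seq M1 (exec_seq E3 M2)))) _ erefl).
  by rewrite [upd _ k.+2 _ k.+2]/upd eqxx size_drop; lia.
by store_eq; first [done | by rewrite s0 //; lia].
Qed.

(** The move brings the first bit of the value to the top. The branches clear what remains, so that
    they start with empty scratch registers. *)
Lemma compile_case e e0 e1 e2 q q0 q1 q2 :
  compile_spec e q -> compile_spec e0 q0 -> compile_spec e1 q1 ->
  compile_spec e2 q2 ->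
  compile_spec (Case e e0 e1 e2)
    (fun N => 6 * q N + q0 N + (q1 N + q2 N) + 3).
Proof.
move=> P P0 P1 P2 env N rho k d s R; have [dk rhoP sP s0 eN] := R.
have [z [n l E]] := compile_temp P R.
have nk : k <> k.+1 by lia.
have M := exec_move (upd s k (rev (eval env e))) nk.
have A1 : upd s k (rev (eval env e)) k = rev (eval env e) by rewrite /upd eqxx.
have A2 : upd s k (rev (eval env e)) k.+1 = [::].
  by rewrite /upd; case: eqP => ?; [lia|apply: s0; lia].
rewrite A1 A2 revK cats0 size_rev in M.
have sE' : upd (upd (upd s k (rev (eval env e))) k [::]) k.+1 [::] = s.
  by store_eq; first [done | by rewrite s0 //; lia].
rewrite /=; case evE: (eval env e) => [|b u].
  have [z0 [n0 l0 E0]] := P0 _ _ _ _ _ _ R.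
  split; first lia.
  rewrite evE in E M; rewrite evE in sE'.
  eexists; last apply: (exec_seq E (exec_seq M (exec_test0 _ _ _ _))).
  - by rewrite /=; instantiate (1 := n0); lia.
  - by rewrite /upd eqxx.
  - by rewrite sE'.
have cl c qc : compile_spec c qc -> size (eval env c) <= qc N /\
   exists2 nc, nc <= qc N + (2 * size u).+1 &
   exec (Seq (clear_reg k.+1) (compile c rho k d)) (upd s k.+1 u) nc
     (upd s d (rev (eval env c) ++ s d)).
  move=> Pc; have [zc [nc lc Ec]] := Pc _ _ _ _ _ _ R; split=> //.
  have C := exec_clear k.+1 (upd s k.+1 u).
  have sE2 : upd (upd s k.+1 u) k.+1 [::] = s by store_eq; first [done | by rewrite s0 //; lia].
  rewrite sE2 in C.
  exists ((2 * size (upd s k.+1 u k.+1)).+1 + nc); last exact: exec_seq C Ec.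
  by rewrite /upd eqxx; lia.
have [zb [nb lb Eb]] : size (eval env (if b then e1 else e2)) <= q1 N + q2 N /\
   exists2 nc, nc <= q1 N + q2 N + (2 * size u).+1 &
   exec (if b then Seq (clear_reg k.+1) (compile e1 rho k d)
     else Seq (clear_reg k.+1) (compile e2 rho k d)) (upd s k.+1 u) nc
     (upd s d (rev (eval env (if b then e1 else e2)) ++ s d)).
  case: b {evE}.
    by have [? [nc lc Ec]] := cl _ _ P1; split; [lia|exists nc => //; lia].
  by have [? [nc lc Ec]] := cl _ _ P2; split; [lia|exists nc => //; lia].
split; first lia.
rewrite evE /= in z M.
rewrite evE in E.
eexists; last apply: (exec_seq E (exec_seq M (@exec_test _ _ _ _ _ _ nb b u _ _))).
- by lia.
- by rewrite /upd eqxx.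
- rewrite (_ : upd (upd _ k.+1 _) k.+1 u = upd s k.+1 u) //.
  by store_eq; first [done | by rewrite s0 //; lia].
Qed.

Lemma compile_correct e : exists2 q, poly_bounded q & compile_spec e q.
Proof.
elim: e => [|b|v|e1 [q1 Q1 P1] e2 [q2 Q2 P2]|v e1 [q1 Q1 P1] e2 [q2 Q2 P2]
           |e1 [q1 Q1 P1] e2 [q2 Q2 P2]
           |e [q Q P] e0 [q0 Q0 P0] e1 [q1 Q1 P1] e2 [q2 Q2 P2]].
- exists (fun=> 1); first exact: poly_const.
  move=> env N rho k d s R; split=> //; exists 1 => //.
  by apply: exec_ext (exec_skip _) _ _ => //; store_eq.
- exists (fun=> 2); first exact: poly_const.
  by move=> env N rho k d s R; split=> //; exists 2 => //; exact: exec_push.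
- exact: compile_var.
- by eexists; last exact: compile_cat P1 P2; poly_tac.
- eexists; last exact: compile_for P1 P2.
  apply: poly_add; last exact: poly_const; apply: poly_add => //.
  apply: poly_mul => //; apply: poly_add; last exact: poly_const.
  by apply: (@poly_comp q2 (fun N => N + q1 N)) => //; apply: poly_add => //; exact: poly_id.
- by eexists; last exact: compile_drop P1 P2; poly_tac.
- by eexists; last exact: compile_case P P0 P1 P2; poly_tac.
Qed.

Lemma eval_polytime e :
  polytime (fun x => eval (upd (fun=> [::]) 0 x) e).
Proof.
have [q [C QC] P] := compile_correct e.
(* Register 0 is the input, 1 the destination, and the empty register 2 serves all other variables.
   The final move puts the result in order. *)
pose c := Seq (compile e (fun v => if v == 0 then 0 else 2) 3 1)
  (Seq (clear_reg 0) (move_reg 1 0)).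
(* For positive [N], [N + 2] is at most [3 * N]; the additive constant covers [N = 0]. *)
have bnd N : 5 * (N + 2) ^ C.+1 <= 5 * 3 ^ C.+1 * N ^ C.+1 + 5 * 3 ^ C.+1.
  rewrite -mulnA -mulnDr leq_mul2l /=; case: N => [|N].
    by rewrite add0n exp0n // muln0 add0n leq_exp2r.
  by apply: (@leq_trans ((3 * N.+1) ^ C.+1)); [rewrite leq_exp2r //; lia|rewrite expnMn; lia].
apply: (@exec_polytime c _ (5 * 3 ^ C.+1) C.+1) => x.
pose s := upd (fun=> [::]) 0 x : store; set v := eval _ e.
have [|z [n l E]] := P (upd (fun=> [::]) 0 x) (size x)
    (fun v => if v == 0 then 0 else 2) 3 1 s.
  split=> // [u|u|r r3|u]; rewrite /s /upd.
  - by case: eqP.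
  - by case: (u == 0).
  - by case: eqP => // ?; lia.
  - by case: eqP.
rewrite -/v in z E.
have E2 := exec_clear 0 (upd s 1 (rev v ++ s 1)).
have n10 : 1 <> 0 by [].
have E3 := exec_move (upd (upd s 1 (rev v ++ s 1)) 0 [::]) n10.
have E4 := exec_seq E (exec_seq E2 E3).
eexists; eexists; split; [|exact: E4|].
  rewrite /= {E E2 E3 E4}; rewrite /upd /= cats0 size_rev.
  apply: leq_trans (bnd _); have := QC (size x); rewrite expnS.
  have p : 0 < (size x + 2) ^ C by rewrite expn_gt0; lia.
  have : (size x + 2) * 1 <= (size x + 2) * (size x + 2) ^ C by rewrite leq_mul2l p orbT.
  have : 2 * (size x + 2) ^ C <= (size x + 2) * (size x + 2) ^ C by rewrite leq_mul2r; lia.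
  by have : size (s 0) = size x by []; lia.
by rewrite /upd /= /s /upd /= !cats0 revK.
Qed.

(** * Definable functions *)

Notation environment := (nat -> seq bool).

Definition str_def (F : environment -> seq bool) : Prop :=
  exists e, forall env, eval env e = F env.

(** Predicates are covered too, through the coercion of booleans to 0 and 1. *)
Definition num_def (F : environment -> nat) : Prop :=
  exists e, forall env, size (eval env e) = F env.

Fixpoint fresh (e : exp) : nat :=
  match e with
  | Empty | Lit _ => 0
  | Var v => v.+1
  | Cat e1 e2 | For _ e1 e2 | Drop e1 e2 => maxn (fresh e1) (fresh e2)
  | Case e e0 e1 e2 =>
      maxn (maxn (fresh e) (fresh e0)) (maxn (fresh e1) (fresh e2))
  end.

Lemma eval_agree e env env' :
  (forall v, v < fresh e -> env v = env' v) -> eval env e = eval env' e.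
Proof.
elim: e env env' => //=.
- by move=> v env env'; exact.
- move=> e1 IH1 e2 IH2 env env' E.
  by rewrite (IH1 env env') ?(IH2 env env') // => v vl; apply: E; rewrite leq_max vl ?orbT.
- move=> u e1 IH1 e2 IH2 env env' E.
  rewrite (IH1 env env') => [|v vl]; last by apply: E; rewrite leq_max vl.
  congr flatten; apply: eq_map => i; apply: IH2 => v vl; rewrite /upd.
  by case: eqP => // _; apply: E; rewrite leq_max vl orbT.
- move=> e1 IH1 e2 IH2 env env' E.
  by rewrite (IH1 env env') ?(IH2 env env') // => v vl; apply: E; rewrite leq_max vl ?orbT.
- move=> e IH e0 IH0 e1 IH1 e2 IH2 env env' E.
  rewrite (IH env env') => [|v vl]; last by apply: E; rewrite !leq_max vl.
  case: (eval env' e) => [|b l].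
    by apply: IH0 => v vl; apply: E; rewrite !leq_max vl ?orbT.
  by case: b; [apply: IH1|apply: IH2] => v vl; apply: E; rewrite !leq_max vl ?orbT.
Qed.

Lemma eval_fresh e env v s :
  fresh e <= v -> eval (upd env v s) e = eval env e.
Proof. by move=> ev; apply: eval_agree => u ul; rewrite /upd; case: eqP => //; lia. Qed.

Lemma str_ext F G : F =1 G -> str_def F -> str_def G.
Proof. by move=> FG [e E]; exists e => env; rewrite E. Qed.

Lemma num_ext F G : F =1 G -> num_def F -> num_def G.
Proof. by move=> FG [e E]; exists e => env; rewrite E. Qed.

Lemma str_var v : str_def (fun env => env v).
Proof. by exists (Var v). Qed.

Lemma str_lit s : str_def (fun=> s).
Proof.
elim: s => [|b s [e E]]; first by exists Empty.
by exists (Cat (Lit b) e) => env /=; rewrite E.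
Qed.

Lemma str_cat F G : str_def F -> str_def G -> str_def (fun env => F env ++ G env).
Proof. by move=> [e E] [e' E']; exists (Cat e e') => env /=; rewrite E E'. Qed.

Lemma str_if (b : environment -> bool) F G :
  num_def (fun env => b env) -> str_def F -> str_def G ->
  str_def (fun env => if b env then F env else G env).
Proof.
move=> [e E] [e1 E1] [e2 E2]; exists (Case e e2 e1 e1) => env /=.
by move: (E env); case: eval => [|[] l]; case: (b env) => //=.
Qed.

(** The index is passed as the length of variable [v]; the first hypothesis says that [H] does not
    otherwise depend on [v], so binding it is harmless. *)
Lemma str_for v F H : (forall env s i, H (upd env v s) i = H env i) ->
  num_def F -> str_def (fun env => H env (size (env v))) ->
  str_def (fun env => flatten [seq H env i | i <- iota 0 (F env)]).
Proof.
move=> Hv [e E] [e' E']; exists (For v e e') => env /=; rewrite E.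
by congr flatten; apply: eq_map => i; rewrite E' Hv /upd eqxx size_nseq.
Qed.

Lemma num_size F : str_def F -> num_def (fun env => size (F env)).
Proof. by move=> [e E]; exists e => env; rewrite E. Qed.

Lemma num_const c : num_def (fun=> c).
Proof. by have [e E] := str_lit (nseq c true); exists e => env; rewrite E size_nseq. Qed.

Lemma num_add F G : num_def F -> num_def G -> num_def (fun env => F env + G env).
Proof. by move=> [e E] [e' E']; exists (Cat e e') => env /=; rewrite size_cat E E'. Qed.

Lemma num_succ F : num_def F -> num_def (fun env => (F env).+1).
Proof.
by move=> P; apply: num_ext (num_add P (num_const 1)) => env; rewrite addn1.
Qed.

Lemma num_sub F G : num_def F -> num_def G -> num_def (fun env => F env - G env).
Proof. by move=> [e E] [e' E']; exists (Drop e' e) => env /=; rewrite size_drop E E'. Qed.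

(* The bound variable is chosen fresh for the body. *)
Lemma num_mul F G : num_def F -> num_def G -> num_def (fun env => F env * G env).
Proof.
move=> [e E] [e' E']; exists (For (fresh e') e e') => env /=.
rewrite -E -E' size_flatten /shape -map_comp sumnE big_map.
under eq_bigr => i _ do rewrite /= eval_fresh //.
by rewrite big_const_seq count_predT size_iota iter_addn_0 mulnC.
Qed.

Lemma num_exp F c : num_def F -> num_def (fun env => F env ^ c).
Proof.
move=> P; elim: c => [|c IH].
  by apply: num_ext (num_const 1) => env; rewrite expn0.
by apply: num_ext (num_mul P IH) => env; rewrite expnS.
Qed.

Lemma num_if (b : environment -> bool) F G :
  num_def (fun env => b env) -> num_def F -> num_def G ->
  num_def (fun env => if b env then F env else G env).
Proof.
move=> [e E] [e1 E1] [e2 E2]; exists (Case e e2 e1 e1) => env /=.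
by move: (E env); case: eval => [|[] l]; case: (b env) => //=.
Qed.

Lemma num_neg (b : environment -> bool) :
  num_def (fun env => b env) -> num_def (fun env => ~~ b env).
Proof.
move=> P; apply: num_ext (num_if P (num_const 0) (num_const 1)) => env.
by case: (b env).
Qed.

Lemma num_and (b b' : environment -> bool) :
  num_def (fun env => b env) -> num_def (fun env => b' env) ->
  num_def (fun env => b env && b' env).
Proof.
move=> P Q; apply: num_ext (num_if P Q (num_const 0)) => env.
by case: (b env).
Qed.

Lemma num_or (b b' : environment -> bool) :
  num_def (fun env => b env) -> num_def (fun env => b' env) ->
  num_def (fun env => b env || b' env).
Proof.
move=> P Q; apply: num_ext (num_if P (num_const 1) Q) => env.
by case: (b env).
Qed.

Lemma num_imply (b b' : environment -> bool) :
  num_def (fun env => b env) -> num_def (fun env => b' env) ->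
  num_def (fun env => b env ==> b' env).
Proof.
move=> P Q; apply: num_ext (num_if P Q (num_const 1)) => env.
by case: (b env).
Qed.

Lemma num_leq F G : num_def F -> num_def G -> num_def (fun env => F env <= G env).
Proof.
move=> [e E] [e' E']; exists (Case (Drop e' e) (Lit true) Empty Empty) => env /=.
rewrite /leq -E -E' -size_drop.
by case: drop => [|[]].
Qed.

Lemma num_eq F G : num_def F -> num_def G -> num_def (fun env => F env == G env).
Proof.
move=> P Q; apply: num_ext (num_and (num_leq P Q) (num_leq Q P)) => env.
by rewrite -eqn_leq.
Qed.

Lemma num_nth F K : str_def F -> num_def K ->
  num_def (fun env => nth false (F env) (K env)).
Proof.
move=> [e E] [k K']; exists (Case (Drop k e) Empty (Lit true) Empty) => env /=.
rewrite K' E -[K env]addn0 -nth_drop addn0.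
by case: drop => [|[]].
Qed.

Lemma num_count v F (P : environment -> nat -> bool) :
  (forall env s i, P (upd env v s) i = P env i) ->
  num_def F -> num_def (fun env => P env (size (env v))) ->
  num_def (fun env => count (P env) (iota 0 (F env))).
Proof.
move=> Pv FP PP.
have : str_def (fun env =>
    flatten [seq (if P env i then [:: true] else [::]) | i <- iota 0 (F env)]).
  apply: (@str_for v _ (fun env i => if P env i then [:: true] else [::])) => //.
    by move=> env s i; rewrite Pv.
  by apply: str_if => //; exact: str_lit.
move/num_size; apply: num_ext => env.
elim: (iota 0 _) => //= i l IH; rewrite size_cat IH.
by case: (P env i).
Qed.

Lemma num_all v F (P : environment -> nat -> bool) :
  (forall env s i, P (upd env v s) i = P env i) ->
  num_def F -> num_def (fun env => P env (size (env v))) ->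
  num_def (fun env => all (P env) (iota 0 (F env))).
Proof.
move=> Pv FP PP; apply: num_ext (num_eq (num_count Pv FP PP) FP) => env.
by rewrite all_count size_iota.
Qed.

Lemma count_ltn_iota q m : count (fun i => i < q) (iota 0 m) = minn q m.
Proof.
elim: m => [|m IH]; first by rewrite minn0.
by rewrite -[m.+1]addn1 iotaD count_cat IH /=; lia.
Qed.

(** The quotient is the number of positive multiples of the divisor up to the dividend; the conjunct
    on positivity gives the value 0 for division by 0. *)
Lemma num_div F G : num_def F -> num_def G -> num_def (fun env => F env %/ G env).
Proof.
move=> [e E] [e' E'].
pose v := maxn (fresh e) (fresh e').
pose F' env := size (eval env e); pose G' env := size (eval env e').
have Fv env s : F' (upd env v s) = F' env by rewrite /F' eval_fresh // leq_maxl.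
have Gv env s : G' (upd env v s) = G' env by rewrite /G' eval_fresh // leq_maxr.
have FP : num_def F' by exists e.
have GP : num_def G' by exists e'.
have C : num_def (fun env =>
    count (fun i => (i.+1 * G' env <= F' env) && (0 < G' env)) (iota 0 (F' env))).
  apply: (@num_count v F' (fun env i => (i.+1 * G' env <= F' env) && (0 < G' env))) => //.
    by move=> env s i; rewrite Fv Gv.
  apply: num_and; last by apply: num_leq => //; exact: num_const.
  apply: num_leq => //; apply: num_mul => //; apply: num_succ.
  exact: num_size (str_var v).
apply: num_ext C => env; rewrite /F' /G' E E'; case: (posnP (G env)) => [->|G0].
  by rewrite divn0; under eq_count => i do rewrite andbF; rewrite count_pred0.
under eq_count => i do rewrite andbT -leq_divRL //.
by rewrite count_ltn_iota; apply/minn_idPl; exact: leq_div.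
Qed.

Lemma num_mod F G : num_def F -> num_def G -> num_def (fun env => F env %% G env).
Proof.
move=> P Q; apply: num_ext (num_sub P (num_mul (num_div P Q) Q)) => env.
by rewrite {1}(divn_eq (F env) (G env)) addKn.
Qed.

(** * Powers of two and binary digits *)

Definition pow2 (n : nat) : bool :=
  (0 < n) && all (fun a => (n %% a == 0) ==> ((a == 1) || (a %% 2 == 0))) (iota 0 n.+1).

Lemma pow2P n : reflect (exists k, n = 2 ^ k) (pow2 n).
Proof.
apply: (iffP andP) => [[n0 /allP nP]|[k ->]].
  suff /p_natP[k ->] : 2.-nat n by exists k.
  apply/pnatP => // p p_pr pn; rewrite inE.
  have pI : p \in iota 0 n.+1 by rewrite mem_iota leq0n /= add0n ltnS dvdn_leq.
  have /implyP/(_ pn) := nP p pI.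
  case/orP => [/eqP p1|]; first by rewrite p1 in p_pr.
  by rewrite -/(2 %| p) (dvdn_prime2 _ p_pr) // eq_sym.
split; first by rewrite expn_gt0.
apply/allP => a _; apply/implyP => /(dvdn_pfactor _ _ (isT : prime 2))[j _ ->].
by case: j => // j; rewrite expnS modnMr orbT.
Qed.

(** The digits are indexed by the powers of two up to [n] instead of by exponents, so that a bounded
    loop with a test produces them in order. *)
Lemma binaryE n : binary n =
  [seq n %/ p %% 2 == 1 | p <- [seq p <- iota 0 n.+1 | pow2 p]].
Proof.
rewrite /binary /mkseq; set L := up_log 2 n.+1.
suff -> : [seq p <- iota 0 n.+1 | pow2 p] = [seq 2 ^ i | i <- iota 0 L].
  by rewrite -map_comp; apply: eq_map => i /=; rewrite modn2; case: odd.
apply: (irr_sorted_eq ltn_trans ltnn).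
- by apply: sorted_filter; [exact: ltn_trans|exact: iota_ltn_sorted].
- rewrite sorted_map; apply: (sub_sorted _ (iota_ltn_sorted 0 L)) => i j.
  by rewrite /= ltn_exp2l.
move=> p; rewrite mem_filter mem_iota add0n /=; apply/andP/mapP.
  move=> [/pow2P[k ->] kn]; exists k => //; rewrite mem_iota add0n /= ltnNge.
  apply: contraL kn => Lk; rewrite -leqNgt.
  by apply: leq_trans (up_logP n.+1 (isT : 1 < 2)) _; rewrite leq_exp2l.
move=> [i]; rewrite mem_iota add0n /= => iL ->; split; first by apply/pow2P; exists i.
rewrite ltnNge; apply: contraL iL => ni; rewrite -leqNgt.
exact: up_log_min.
Qed.

Lemma str_nat F : num_def F -> str_def (fun env => encode_nat (F env)).
Proof.
move=> [e E]; pose v := fresh e; pose w := v.+1; pose F' env := size (eval env e).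
have Fv env s : F' (upd env v s) = F' env by rewrite /F' eval_fresh.
have FP : num_def F' by exists e.
pose H env p := if pow2 p then [:: true; F' env %/ p %% 2 == 1] else [::].
have : str_def (fun env => flatten [seq H env p | p <- iota 0 (F' env).+1] ++ [:: false]).
  apply: str_cat; last exact: str_lit.
  apply: (@str_for v).
  - by move=> env s i; rewrite /H Fv.
  - exact: num_succ.
  have Vv u : num_def (fun env => size (env u)) by apply: num_size (str_var u).
  apply: str_if; last exact: str_lit.
    rewrite /pow2; apply: num_and; first by apply: num_leq; [exact: num_const|].
    apply: (@num_all w _ (fun env a => (size (env v) %% a == 0) ==> ((a == 1) || (a %% 2 == 0)))).
    - by move=> env s i; rewrite /upd /w (ltn_eqF (ltnSn v)).
    - exact: num_succ.
    apply: num_imply; first by apply: num_eq; [exact: num_mod|exact: num_const].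
    apply: num_or; apply: num_eq; try exact: num_const; first exact: Vv.
    by apply: num_mod; [|exact: num_const].
  pose b env := F' env %/ size (env v) %% 2 == 1.
  apply: (@str_ext (fun env => true :: if b env then [:: true] else [:: false])).
    by move=> env; rewrite /b; case: eqP.
  apply: (str_cat (str_lit [:: true])); apply: str_if; try exact: str_lit.
  apply: num_eq; last exact: num_const; apply: num_mod; last exact: num_const.
  exact: num_div.
apply: str_ext => env; rewrite /encode_nat /encode_bits /encode_seq binaryE /F' E.
congr (_ ++ _); rewrite -map_comp /H /F' E.
by elim: (iota 0 _) => //= p l IH; case: pow2; rewrite /= IH.
Qed.

(** * From conflict graphs to the min-sum problem *)

(** An increasing enumeration stays increasing under filtering, which turns preferences into
    comparisons of numbers. *)
Lemma index_enum_filter k (P : pred 'I_k) (x y : 'I_k) :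
  P x -> P y ->
  (index x [seq z <- enum 'I_k | P z] < index y [seq z <- enum 'I_k | P z]) = (x < y).
Proof.
move=> Px Py; set l := filter _ _.
have xl : x \in l by rewrite mem_filter Px mem_enum.
have yl : y \in l by rewrite mem_filter Py mem_enum.
have tr : transitive (relpre (@nat_of_ord k) ltn) by move=> a b c; exact: ltn_trans.
have sl : sorted (relpre (@nat_of_ord k) ltn) l.
  by apply: sorted_filter => //; rewrite -sorted_map val_enum_ord iota_ltn_sorted.
apply/idP/idP => [|xy]; first by move/(sorted_ltn_index tr sl) => /(_ xl yl).
rewrite ltnNge; apply/negP; rewrite leq_eqVlt => /orP[/eqP/(index_inj x yl xl) E|].
  by rewrite E ltnn in xy.
by move/(sorted_ltn_index tr sl) => /(_ yl xl) /=; lia.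
Qed.

(** * Instances whose preferences follow the numbering *)

Section SortedInstance.
Variables (na np : nat) (adj : nat -> nat -> bool) (cost : nat -> nat).

(** Both sides prefer smaller numbers, so the full enumerations are master lists. *)
Definition sorted_instance : instance.
refine (@Build_instance na np (fun a p => adj a p)
  (fun a => [seq p : 'I_np <- enum 'I_np | adj a p])
  (fun p => [seq a : 'I_na <- enum 'I_na | adj a p])
  (fun p => cost p) _ _ _ _).
- by move=> a; apply: filter_uniq; exact: enum_uniq.
- by move=> a p; rewrite mem_filter mem_enum andbT.
- by move=> a; apply: filter_uniq; exact: enum_uniq.
- by move=> a p; rewrite mem_filter mem_enum andbT.
Defined.

Lemma enum_filter_seq k (P : pred nat) T (F : nat -> T) :
  [seq F (val i) | i <- [seq i : 'I_k <- enum 'I_k | P i]] =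
  [seq F i | i <- [seq i <- iota 0 k | P i]].
Proof. by rewrite -[in RHS]val_enum_ord filter_map -map_comp. Qed.

Lemma enum_seq k T (F : nat -> T) :
  [seq F (val i) | i <- enum 'I_k] = [seq F i | i <- iota 0 k].
Proof. by rewrite -[in RHS]val_enum_ord -map_comp. Qed.

Lemma encode_sorted_instance :
  encode_instance sorted_instance =
  encode_seq (encode_seq encode_nat)
    [seq [seq p <- iota 0 np | adj a p] | a <- iota 0 na] ++
  encode_seq (encode_seq encode_nat)
    [seq [seq a <- iota 0 na | adj a p] | p <- iota 0 np] ++
  encode_seq encode_nat [seq cost p | p <- iota 0 np].
Proof.
rewrite /encode_instance /=; congr (_ ++ (_ ++ _)).
- rewrite -(enum_seq na (fun a => [seq p <- iota 0 np | adj a p])).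
  by congr encode_seq; apply: eq_map => a; rewrite -[RHS]map_id -(enum_filter_seq _ _ id).
- rewrite -(enum_seq np (fun p => [seq a <- iota 0 na | adj a p])).
  by congr encode_seq; apply: eq_map => a; rewrite -[RHS]map_id -(enum_filter_seq _ _ id).
- by rewrite -enum_seq.
Qed.

Lemma restricted_sorted_instance f :
  (forall a, a < na -> count (adj a) (iota 0 np) = f) ->
  size (undup [seq cost p | p <- iota 0 np]) = 2 ->
  restricted f sorted_instance.
Proof.
move=> adjP costP; split.
- move=> a; rewrite -(adjP a) // -val_enum_ord count_map size_filter.
  by apply: eq_count.
- exists (enum 'I_np) => // a; exact: filter_subseq.
- exists (enum 'I_na) => // p; exact: filter_subseq.
- by rewrite -costP /codom /image_mem /= enum_seq.
Qed.

(** The second clause is stability: with smaller numbers preferred, [a] blocks at the program of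
    [a'] exactly if [a < a'], the two are adjacent and [mu a' < mu a]. *)
Definition nat_matching (mu : nat -> nat) : Prop :=
  (forall a, a < na -> mu a < np /\ adj a (mu a)) /\
  (forall a a', a < a' -> a' < na -> adj a (mu a') -> mu a <= mu a').

Lemma assignment_nat c :
  (exists2 M : assignment sorted_instance,
     [/\ is_matching M, agent_perfect M & stable M] & total_cost M <= c) <->
  (exists2 mu, nat_matching mu & \sum_(a < na) cost (mu a) <= c).
Proof.
have costE (M : assignment sorted_instance) (mu : nat -> nat) :
    (forall a : 'I_na, exists2 p, M a = Some p & mu (val a) = p) ->
    total_cost M = \sum_(a < na) cost (mu a).
  move=> Mmu; rewrite /total_cost /=.
  transitivity (\sum_(p < np) \sum_(a < na | M a == Some p) cost p).
    by apply: eq_bigr => p _; rewrite sum_nat_const cardsE.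
  rewrite (exchange_big_dep xpredT) //=; apply: eq_bigr => a _.
  have [p Ma ->] := Mmu a; rewrite (big_pred1 p) // => q.
  by rewrite Ma eq_sym.
split=> [[M [Mm Mp Ms] Mc]|[mu [muP muS] muc]].
- pose mu a := if insub a is Some i then oapp (@nat_of_ord np) 0 (M i) else 0.
  have muE (a : 'I_na) : exists2 p, M a = Some p & mu (val a) = p.
    rewrite /mu valK; case Ma: (M a) => [p|]; first by exists p.
    by have := Mp a; rewrite Ma.
  exists mu; last by rewrite -(costE M mu muE).
  split=> [a al|a a' aa' al' ad].
    have [p Ma /= ->] := muE (Ordinal al); split=> //; exact: (Mm _ _ Ma).
  have al := ltn_trans aa' al'.
  have [p Ma /= muaE] := muE (Ordinal al).
  have [p' Ma' /= muaE'] := muE (Ordinal al').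
  rewrite leqNgt; apply/negP => lt; apply: (Ms (Ordinal al) p'); split.
  + by rewrite /= -muaE'.
  + by rewrite Ma => -[pp]; move: lt; rewrite muaE muaE' pp ltnn.
  + rewrite Ma /agent_prefers /= index_enum_filter /=; first by rewrite -muaE' -muaE.
      by rewrite -muaE'.
    exact: (Mm _ _ Ma).
  + exists (Ordinal al') => //; rewrite /program_prefers /= index_enum_filter //=.
      by rewrite -muaE'.
    exact: (Mm _ _ Ma').
- pose M : assignment sorted_instance := [ffun a : 'I_na => insub (mu a)].
  have MP (a : 'I_na) : exists2 p, M a = Some p & mu (val a) = p.
    have [al ad] := muP a (ltn_ord a).
    by exists (Ordinal al) => //; rewrite ffunE insubT.
  have Mm : is_matching M.
    by move=> a p; have [p' -> E] := MP a => -[<-] /=; rewrite -E; apply: (muP _ _).2.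
  exists M; last by rewrite (costE M mu MP).
  split=> // [a|a p [ad Ma pref [a' Ma' pref']]].
    by have [p' -> _] := MP a.
  have [q Maq E] := MP a; have [q' E1 E'] := MP a'.
  move: E1; rewrite Ma' => -[qE]; subst q'.
  rewrite Maq /agent_prefers /= index_enum_filter //= in pref; last exact: (Mm _ _ Maq).
  rewrite /program_prefers /= index_enum_filter //= in pref'; last exact: (Mm _ _ Ma').
  have := muS a a' pref' (ltn_ord _); rewrite E E' /= => /(_ ad).
  by rewrite leqNgt pref.
Qed.

End SortedInstance.

(** Descending on [c] from a feasible solution reaches one of minimum cost, so the decision problem
    may be studied on feasible solutions. *)
Lemma optimal_exists (I : instance) c :
  (exists2 M : assignment I, optimal (P := min_sum) M & total_cost M <= c) <->
  (exists2 M : assignment I, mp_feasible (m := min_sum) M & total_cost M <= c).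
Proof.
split=> [[M [Mf _] Mc]|]; first by exists M.
elim: c => [|c IH] [M Mf Mc].
  by exists M => //; split=> // M' _; apply: leq_trans Mc _.
have [[M' M'f M'c]|no] := classic (exists2 M' : assignment I,
  mp_feasible (m := min_sum) M' & total_cost M' <= c).
  have [|M0 M0o M0c] := IH; first by exists M'.
  by exists M0 => //; exact: leqW.
exists M => //; split=> // M' M'f; rewrite /=; case: (leqP (total_cost M') c) => [le|lt].
  by case: no; exists M'.
exact: leq_trans Mc lt.
Qed.

(** * The instance of a conflict graph *)

Section Reduction.
Variables (n g : nat) (conf : nat -> nat -> bool).

(* Agents are numbered [w * n + v] with [v < n]: guards for [w = 0], the vertex
   [v] for [w = 1], and the pair [(w - 2, v)] otherwise.  Programs [v < n] stand
   for "[v] is in the cover", [n + g + 2] is the only free one, and the others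
   are padding; the guards keep everybody else away from all of it but
   [n + g + 1], the way out for the pairs without conflict. *)
Definition adjacent (a p : nat) : bool :=
  let w := a %/ n in let v := a %% n in
  if w == 0 then (n <= p < n + g.+1) || (p == n + g.+2)
  else if w == 1 then (p == v) || (n <= p < n + g) || (p == n + g.+2)
  else if (w - 2 < v) && conf (w - 2) v then
    (p == w - 2) || (p == v) || (n <= p < n + g)
  else n <= p < n + g.+2.

Definition num_agent := (n + 2) * n.
Definition num_program := n + g.+3.
Definition cost (p : nat) : nat := p != n + g.+2.

Definition conflict_instance := sorted_instance num_agent num_program adjacent cost.

Lemma count_split (b b0 b1 : pred nat) :
  (forall p, p < n -> b p = b0 p) -> (forall j, b (n + j) = b1 j) ->
  count b (iota 0 num_program) =
  count b0 (iota 0 n) + count b1 (iota 0 g.+3).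
Proof.
move=> b0P b1P; rewrite /num_program iotaD count_cat add0n.
congr (_ + _).
  by apply: eq_in_count => p; rewrite mem_iota => /andP[_]; exact: b0P.
by rewrite -[X in iota X]addn0 iotaDl count_map; apply: eq_count => j /=.
Qed.

Lemma count_tail (b : pred nat) b0 b1 b2 :
  (forall j, j < g -> b j) -> b g = b0 -> b g.+1 = b1 -> b g.+2 = b2 ->
  count b (iota 0 g.+3) = g + (b0 + (b1 + b2)).
Proof.
move=> bP <- <- <-; rewrite -addn3 iotaD count_cat add0n /= addn0; congr (_ + _).
rewrite -[RHS](size_iota 0); apply/eqP; rewrite -all_count; apply/allP => j.
by rewrite mem_iota => /andP[_]; exact: bP.
Qed.

Lemma count_pred1_iota u : u < n -> count (pred1 u) (iota 0 n) = 1.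
Proof. by move=> un; rewrite count_uniq_mem ?iota_uniq // mem_iota un. Qed.

(** Guards have [g.+1] padding programs and the free one; a vertex its own program, [g] padding ones
    and the free one; a conflicting pair its two ends and [g] padding ones; any other pair [g.+2]
    padding ones. *)
Lemma adjacent_size a : 0 < n -> a < num_agent ->
  count (adjacent a) (iota 0 num_program) = g.+2.
Proof.
move=> n0; rewrite /num_agent -ltn_divLR // /adjacent => wn.
have vn := ltn_pmod a n0; move: (a %/ n) (a %% n) wn vn => w v wn vn.
case: (w == 0).
  rewrite (count_split (b0 := pred0) (b1 := fun j => (j < g.+1) || (j == g.+2))).
  - by rewrite count_pred0 (@count_tail _ true false true) => *; lia.
  - by move=> p *; rewrite /=; lia.
  - by move=> p *; rewrite /=; lia.
case: (w == 1).
  rewrite (count_split (b0 := pred1 v) (b1 := fun j => (j < g) || (j == g.+2))).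
  - by rewrite count_pred1_iota // (@count_tail _ false false true) => *; lia.
  - by move=> p pn /=; lia.
  - by move=> p *; rewrite /=; lia.
case: andP => [[uv _]|_]; last first.
  rewrite (count_split (b0 := pred0) (b1 := fun j => j < g.+2)).
  - by rewrite count_pred0 (@count_tail _ true true false) => *; lia.
  - by move=> p *; rewrite /=; lia.
  - by move=> p *; rewrite /=; lia.
rewrite (count_split (b0 := predU (pred1 (w - 2)) (pred1 v)) (b1 := fun j => j < g)).
- have := count_predUI (pred1 (w - 2)) (pred1 v) (iota 0 n).
  rewrite (eq_count (a2 := pred0) (a1 := predI _ _)) => [|p /=]; last lia.
  rewrite !count_pred1_iota //; last lia.
  by rewrite count_pred0 addn0 => ->; rewrite (@count_tail _ false false false) => *; lia.
- by move=> p pn; rewrite /=; lia.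
- by move=> p; rewrite /=; lia.
Qed.

Lemma cost_values : size (undup [seq cost p | p <- iota 0 num_program]) = 2.
Proof.
rewrite -[2]/(size [:: 0; 1]); apply/perm_size/uniq_perm => //.
  exact: undup_uniq.
move=> c; rewrite mem_undup !inE; apply/mapP/orP.
  by move=> [p _ ->]; rewrite /cost; case: (p != _); [right|left].
case=> /eqP ->.
  exists (n + g.+2); last by rewrite /cost eqxx.
  by rewrite mem_iota /num_program; lia.
exists (n + g.+1); first by rewrite mem_iota /num_program; lia.
by rewrite /cost eqn_add2l eqSS (ltn_eqF (ltnSn g)).
Qed.

Lemma conflict_restricted : 0 < n -> restricted g.+2 conflict_instance.
Proof.
by move=> n0; apply: restricted_sorted_instance cost_values => a; exact: adjacent_size.
Qed.

Lemma sum_agents (F : nat -> nat) :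
  \sum_(a < num_agent) F a =
  \sum_(i < n) F i + \sum_(v < n) F (n + v) + \sum_(i < n * n) F (2 * n + i).
Proof.
have -> : num_agent = n + n + n * n by rewrite /num_agent mulnDl; lia.
by rewrite !big_split_ord /=; congr (_ + _); apply: eq_bigr => i _; rewrite mul2n -addnn.
Qed.

Lemma count_sum (b : pred nat) k : \sum_(i < k) b i = count b (iota 0 k).
Proof.
rewrite -sum1_count -(big_mkord xpredT (fun i => nat_of_bool (b i))).
by rewrite /index_iota subn0 [RHS]big_mkcond; apply: eq_bigr => i _; case: (b i).
Qed.

Lemma agentE w v : v < n -> (w * n + v) %/ n = w /\ (w * n + v) %% n = v.
Proof.
move=> vn; have n0 : 0 < n by lia.
by rewrite divnMDl // (divn_small vn) addn0 modnMDl modn_small.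
Qed.

(** The vertices on the free program form the independent set. The [n * n] pairs always pay, so
    [n - m] is left for guards and vertices together. *)
Lemma conflict_correct m : 0 < m <= n ->
  (exists2 mu, nat_matching num_agent num_program adjacent mu
             & \sum_(a < num_agent) cost (mu a) <= n * n + (n - m)) <->
  (exists2 s : pred nat, m <= count s (iota 0 n)
             & forall u v, u < v -> v < n -> s u -> s v -> ~~ conf u v).
Proof.
move=> /andP[m0 mn]; have n0 : 0 < n by lia.
pose q := n + g.+2.
split=> [[mu [muP muS]]|[s sm sP]].
- rewrite (sum_agents (fun a => cost (mu a))).
  (* No pair is adjacent to the free program. *)
  have -> : \sum_(i < n * n) cost (mu (2 * n + i)) = n * n.
    rewrite -[RHS](card_ord) -sum1_card; apply: eq_bigr => i _.
    have al : 2 * n + i < num_agent.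
      by have := ltn_ord i; rewrite /num_agent mulnDl; lia.
    have [_] := muP _ al; rewrite /adjacent /cost.
    have -> : (2 * n + i) %/ n = 2 + i %/ n by rewrite divnMDl.
    have := ltn_pmod (2 * n + i) n0.
    have : i %/ n < n by rewrite ltn_divLR.
    rewrite /=; case: ifP; lia.
  rewrite addnC leq_add2l => H.
  have sE : \sum_(v < n) cost (mu (n + v)) + count (fun v => mu (n + v) == q) (iota 0 n) = n.
    rewrite (count_sum (fun v => mu (n + v) != q)) -[RHS](size_iota 0 n).
    by rewrite addnC -(count_predC (fun v => mu (n + v) == q)).
  (* As [m] is positive, the [n] guards cannot all pay. *)
  have [i iN muq] : exists2 i, i < n & mu i = q.
    have : \sum_(i < n) cost (mu i) < n by lia.
    rewrite (count_sum (fun v => mu v != q)) -[X in _ < X](size_iota 0 n).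
    rewrite ltn_neqAle -all_count => /andP[/allPn[i]].
    by rewrite mem_iota negbK => /andP[_ iN] /eqP; exists i.
  exists (fun v => mu (n + v) == q) => [|u v uv vn /eqP su /eqP sv]; first lia.
  apply/negP => cuv; pose a := u.+2 * n + v.
  have an : a < num_agent by rewrite /a /num_agent addn2; nia.
  have [aw av] : a %/ n = u.+2 /\ a %% n = v by exact: agentE.
  have vE x : x < n -> (n + x) %/ n = 1 /\ (n + x) %% n = x.
    by move=> xn; have := agentE 1 xn; rewrite mul1n.
  have [_] := muP _ an; rewrite {1}/adjacent aw av subn2 /= uv cuv /=.
  have un : u < n by lia.
  (* Wherever the pair goes, an earlier agent on the free program blocks: the vertex [u], the vertex
     [v], or, on the padding, the guard [i]. *)
  case/orP => [/orP[/eqP ma|/eqP ma]|ma].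
  + have := muS (n + u) a; rewrite ma su /adjacent (vE u un).1 (vE u un).2 /= eqxx /q /a.
    by move=> /(_ _ an isT); nia.
  + have := muS (n + v) a; rewrite ma sv /adjacent (vE v vn).1 (vE v vn).2 /= eqxx /q /a.
    by move=> /(_ _ an isT); nia.
  + have ia : i < a by rewrite /a; nia.
    have := muS i a ia an; rewrite muq /adjacent divn_small //= /q.
    by lia.
(* Guards and chosen vertices take the free program, other vertices their own, conflicting pairs the
   smaller end outside [s], and the remaining pairs [n + g.+1], to which no guard or vertex is
   adjacent. *)
- pose mu a := let w := a %/ n in let v := a %% n in
    if w == 0 then q else if w == 1 then (if s v then q else v)
    else if (w - 2 < v) && conf (w - 2) v then (if s (w - 2) then v else w - 2)
    else n + g.+1.
  exists mu; first split.
  + move=> a; rewrite /num_agent -ltn_divLR // /mu /adjacent /num_program /q => wn.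
    have vn := ltn_pmod a n0; move: (a %/ n) (a %% n) wn vn => w v wn vn.
    case: (w == 0); first lia.
    case: (w == 1); first by case: (s v); lia.
    by case: andP => [[uv _]|_]; [case: (s _)|]; lia.
  + move=> a a' aa'; rewrite /num_agent -ltn_divLR // /adjacent /mu /q.
    have vn := ltn_pmod a n0; have vn' := ltn_pmod a' n0.
    have aE := divn_eq a n; have aE' := divn_eq a' n; move: aE aE' aa'.
    move: (a %/ n) (a %% n) (a' %/ n) (a' %% n) vn vn' => w v w' v' vn vn' -> -> aa' wn'.
    have ww : w <= w' by nia.
    set p := (if w' == 0 then _ else _).
    (* The possible programs of the later agent [a'], at which the earlier agent [a] must not
       block. *)
    have pP : [\/ p = q, p = n + g.+1, [/\ w' = 1, p = v' & ~~ s v']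
      | [/\ 1 < w', w' - 2 < v', conf (w' - 2) v'
          & p = if s (w' - 2) then v' else w' - 2]].
      rewrite /p; case: (eqVneq w' 0) => [_|w0]; first by constructor 1.
      case: (eqVneq w' 1) => [w1|w1].
        by case sv: (s v'); [constructor 1|constructor 3].
      by case: andP => [[uv c]|_]; [constructor 4; split=> //; lia|constructor 2].
    move: p pP => p pP; case: (eqVneq w 0) => [w0|w0].
      case: pP => [->|->|[_ -> _]|[_ ? _]]; rewrite /q /=; try lia.
      by case: (s _) => ->; lia.
    case: (eqVneq w 1) => [w1|w1].
      case sv: (s v); last first.
        by case: pP => [->|->|[? -> _]|[? ? _]]; rewrite /q /=; nia.
      (* A chosen vertex could only block at its own program, but no later agent holds it: by
         independence, conflicting pairs sit at ends outside [s]. *)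
      case: pP => [->|->|[w1' -> sv']|[w1' uv' c' ->]]; rewrite /q /=; try lia.
      case su': (s (w' - 2)).
        case: (eqVneq v v') => [vE|]; last lia.
        by have := sP _ _ uv' vn' su'; rewrite c' -vE sv => /(_ isT).
      by case: (eqVneq v (w' - 2)) => [vE|]; [move: su'; rewrite -vE sv|lia].
    case: andP => [[uv c]|_]; last first.
      case: pP => [->|->|[_ -> _]|[_ ? _]]; rewrite /q /=; try lia.
      by case: (s _) => ->; lia.
    case su: (s (w - 2)); last first.
      case: pP => [->|->|[? -> _]|[? ? _]]; rewrite /q /=; try lia.
    (* The pair is at its larger end because the smaller one is in [s], and then no later pair
       occupies the smaller end. *)
    case: pP => [->|->|[w1' _ _]|[w1' uv' c' ->]]; rewrite /q /=; try lia.
    case su': (s (w' - 2)).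
      case: (eqVneq (w - 2) v') => [vE|]; last lia.
      by have := sP _ _ uv' vn' su'; rewrite c' -vE su => /(_ isT).
    by case: (eqVneq (w - 2) (w' - 2)) => [vE|]; [move: su'; rewrite -vE su|lia].
  + rewrite (sum_agents (fun a => cost (mu a))) addnC; apply: leq_add.
      rewrite -[X in _ <= X]card_ord -sum1_card; apply: leq_sum => i _.
      by rewrite /cost; case: (_ != _).
    rewrite big1 => [|i _]; last by rewrite /mu divn_small //= /cost /q eqxx.
    have : count (predC s) (iota 0 n) <= n - m.
      by have := count_predC s (iota 0 n); rewrite size_iota; lia.
    rewrite add0n; apply: leq_trans; rewrite -count_sum; apply: leq_sum => i _.
    have [w v] := agentE 1 (ltn_ord i); rewrite mul1n in w v.
    by rewrite /mu w v /= /cost; case: (s i); rewrite /q ?eqxx //=; case: (_ != _).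
Qed.

End Reduction.

(* The vertex [c * delta + j] stands for "cell [c] has content [j]". *)
Lemma selection_assignment m delta (conf : nat -> nat -> bool) : 0 < delta ->
  (forall u v, u < v -> u %/ delta = v %/ delta -> conf u v) ->
  (exists2 s : pred nat, m <= count s (iota 0 (m * delta))
     & forall u v, u < v -> v < m * delta -> s u -> s v -> ~~ conf u v) <->
  (exists2 tau : nat -> nat, forall c, c < m -> tau c < delta
     & forall c c', c < c' -> c' < m ->
         ~~ conf (c * delta + tau c) (c' * delta + tau c')).
Proof.
move=> d0 cellP; split=> [[s sm sP]|[tau tauD tauP]].
- set l := [seq u <- iota 0 (m * delta) | s u].
  have lP u : (u \in l) = s u && (u < m * delta) by rewrite mem_filter mem_iota.
  have cells_uniq : uniq [seq u %/ delta | u <- l].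
    rewrite map_inj_in_uniq ?filter_uniq ?iota_uniq // => u v.
    rewrite !lP => /andP[su ul] /andP[sv vl] uv.
    case: (ltngtP u v) => // lt.
      by have := sP _ _ lt vl su sv; rewrite cellP.
    by have := sP _ _ lt ul sv su; rewrite cellP.
  have sub : {subset [seq u %/ delta | u <- l] <= iota 0 m}.
    move=> _ /mapP[u ul ->]; rewrite lP in ul; case/andP: ul => _ ul.
    by rewrite mem_iota /= add0n ltn_divLR.
  (* Selected vertices lie in different cells, so [m] of them meet all [m] cells. *)
  have [|_ cellsE] := uniq_min_size cells_uniq sub.
    by rewrite size_iota size_map size_filter.
  pose tau c := find (fun j => s (c * delta + j)) (iota 0 delta).
  have tauD c : c < m -> tau c < delta.
    move=> cm; have : c \in iota 0 m by rewrite mem_iota.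
    rewrite -cellsE => /mapP[u]; rewrite lP => /andP[su ul] cE.
    rewrite /tau -[X in _ < X](size_iota 0) -has_find; apply/hasP.
    by exists (u %% delta); rewrite ?mem_iota ?ltn_pmod // cE -divn_eq.
  have tauS c : c < m -> s (c * delta + tau c).
    move=> /tauD cD; have := cD; rewrite /tau -[X in _ < X](size_iota 0) -has_find.
    by move=> /(nth_find 0); rewrite nth_iota.
  exists tau => // c c' cc' c'm; have cm := ltn_trans cc' c'm.
  have := tauD _ cm; have := tauD _ c'm => d' d.
  by apply: sP; [nia|nia|exact: tauS|exact: tauS].
- have tE c : c < m -> (c * delta + tau c) %/ delta = c /\ (c * delta + tau c) %% delta = tau c.
    by move=> /tauD cD; rewrite divnMDl // divn_small // addn0 modnMDl modn_small.
  exists (fun u => tau (u %/ delta) == u %% delta).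
    rewrite -size_filter -[X in X <= _](size_iota 0) -(size_map (fun c => c * delta + tau c)).
    apply: uniq_leq_size.
      rewrite map_inj_in_uniq ?iota_uniq // => c c'; rewrite !mem_iota /= !add0n => cm c'm E.
      by rewrite -(tE c cm).1 E (tE c' c'm).1.
    move=> _ /mapP[c cm ->]; rewrite mem_iota /= add0n in cm.
    rewrite mem_filter mem_iota (tE c cm).1 (tE c cm).2 eqxx /=.
    by have := tauD c cm; nia.
  move=> u v uv vm /eqP su /eqP sv.
  have [uvd|uvd] := eqVneq (u %/ delta) (v %/ delta).
    by move: uv; rewrite {1}(divn_eq u delta) -su uvd sv -divn_eq ltnn.
  rewrite {1}(divn_eq u delta) -su {1}(divn_eq v delta) -sv; apply: tauP.
    by rewrite ltn_neqAle uvd leq_div2r // ltnW.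
  by rewrite ltn_divLR.
Qed.

(** * Tableaux *)

(* The content of position [p] of a tape whose head is at position [c]. *)
Definition cell_at G (c : nat) (t : tape G) (p : nat) : symbol G :=
  if p < c then nth None t.1 (c - p.+1) else nth None t.2 (p - c).

Definition is_move (m m' : move) : bool :=
  match m, m' with Left, Left | Stay, Stay | Right, Right => true | _, _ => false end.

(** Relative to a head that moves left, the symbols move one position to the right. *)
Definition shifts (m : move) (p p' : nat) : bool :=
  match m with Left => p' == p.+1 | Stay => p' == p | Right => p == p'.+1 end.

Lemma is_moveP m m' : is_move m m' -> m = m'.
Proof. by case: m; case: m'. Qed.

(* The head stays at position [c] and the tape moves below it. *)
Lemma cell_at_move G c (t : tape G) m s p p' : shifts m p p' ->
  cell_at c (tape_move m (tape_write s t)) p' =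
  if p == c then s else cell_at c t p.
Proof.
case: t => l r; case: m => /= /eqP => [-> | -> | ->]; rewrite /cell_at /=.
- case: (ltngtP p c) => [pc|pc|->].
  + case: ltnP => pc'; first by rewrite nth_behead; congr nth; lia.
    have -> : c = p.+1 by lia.
    by rewrite subnn /=; case: l.
  + have -> : (p.+1 < c) = false by lia.
    have -> : p.+1 - c = (p - c).-1.+2 by lia.
    by rewrite /= nth_behead; congr nth; lia.
  + have -> : (c.+1 < c) = false by lia.
    by rewrite subSnn.
- case: (ltngtP p c) => [//|pc|->]; last by rewrite subnn.
  have -> : p - c = (p - c).-1.+1 by lia.
  by rewrite /= nth_behead.
- case: (ltngtP p'.+1 c) => [pc|pc|pc].
  + have -> : c - p'.+1 = (c - p'.+2).+1 by lia.
    by [].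
  + by rewrite nth_behead; congr nth; lia.
  + by rewrite pc subnn.
Qed.

Section Tableau.
Variable M : TM.

Definition reads_of (tp : tm_tape M -> tape (tm_aux M)) :
  {ffun tm_tape M -> option (bool + tm_aux M)} := [ffun i => tape_read (tp i)].

(* A halted configuration is repeated for ever. *)
Definition next (q : tm_state M) (g : {ffun tm_tape M -> option (bool + tm_aux M)}) :
    tm_state M * (tm_tape M -> symbol (tm_aux M) * move) :=
  if tm_trans q g is Some r then r else (q, fun i => (g i, Stay)).

Definition run (x : seq bool) (t : nat) : config M :=
  iter t (fun cf => odflt cf (step cf)) (init_config M x).

(** Since halted configurations are repeated, the output can be read at one fixed time for all
    certificates. *)
Lemma halts_run x t T y : halts_with M x t y -> t <= T ->
  bits_of_cells ((run x T).2 (tm_io M)).2 = y.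
Proof.
move=> [cf [it st out]] tT.
have it' : run x t = cf.
  rewrite /run; elim: t cf it {st out tT} => [cf [<-] //|t IH cf] /=.
  case E: (iter t _ _) => [cf'|] //= st; by rewrite (IH cf' E) st.
have -> : run x T = cf.
  rewrite -(subnK tT) /run iterD -/(run x t) it'.
  by elim: (T - t) => //= k ->; rewrite st.
exact: out.
Qed.

Lemma runS_state x t :
  (run x t.+1).1 = (next (run x t).1 (reads_of (run x t).2)).1.
Proof.
rewrite /run iterS -/(run x t); set cf := run x t.
by rewrite /step /next /reads_of; case: tm_trans => [[]|].
Qed.

Lemma runS_cell x t c i p p' :
  shifts ((next (run x t).1 (reads_of (run x t).2)).2 i).2 p p' ->
  cell_at c ((run x t.+1).2 i) p' =
  if p == c then ((next (run x t).1 (reads_of (run x t).2)).2 i).1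
  else cell_at c ((run x t).2 i) p.
Proof.
rewrite /run iterS -/(run x t); set cf := run x t.
rewrite /step /next /reads_of; case: tm_trans => [[q a]|] /=.
  exact: cell_at_move.
move=> /eqP ->; case: eqP => // ->; rewrite ffunE /cell_at ltnn subnn.
by rewrite /tape_read nth0.
Qed.

(** State, scanned symbols, and symbols at the position. The first two are repeated in every cell of
    a row, so that each cell knows the transition to apply. *)
Definition content : finType :=
  (tm_state M * {ffun tm_tape M -> option (bool + tm_aux M)} *
   {ffun tm_tape M -> option (bool + tm_aux M)})%type.

Definition io_vector (o : option (bool + tm_aux M)) :
    {ffun tm_tape M -> option (bool + tm_aux M)} :=
  [ffun i => if i == tm_io M then o else None].

Definition is_bit (o : option (bool + tm_aux M)) : bool :=
  if o is Some (inl _) then true else false.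

(* [d'], one step after [d], is consistent with [d] on the tapes moved by [m];
   [at_head] tells whether [d] is at the head position. *)
Definition follows (m : move) (at_head : bool) (d d' : content) : bool :=
  [forall i, is_move ((next d.1.1 d.1.2).2 i).2 m ==>
    (d'.2 i == if at_head then ((next d.1.1 d.1.2).2 i).1 else d.2 i)].

(** Row 0 holds the start state and, from the head on, the input [z] and a certificate within the
    next [B] cells; row [T] demands the output [[:: true]]. Tests on [d] are kept apart from [z], so
    that for fixed [d] they are constants. *)
Definition good1 (z : seq bool) (B T t p : nat) (d : content) : bool :=
  let c := T.+1 in
  [&& (p == c) ==> (d.1.2 == d.2),
      (t == 0) ==> (d.1.1 == tm_start M),
      (t == 0) && (p < c) ==> (d.2 == io_vector None),
      (t == 0) && (c <= p) && (p - c < size z) ==>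
        (if nth false z (p - c) then d.2 == io_vector (Some (inl true))
         else d.2 == io_vector (Some (inl false))),
      (t == 0) && (c + size z <= p) ==>
        [|| d.2 == io_vector None, d.2 == io_vector (Some (inl true))
          | d.2 == io_vector (Some (inl false))],
      (t == 0) && (c + size z + B <= p) ==> (d.2 == io_vector None),
      (t == T) ==> (d.1.2 (tm_io M) == Some (inl true))
    & (t == T) && (p == c.+1) ==> ~~ is_bit (d.2 (tm_io M))].

(** Cells of one row share state and scanned symbols; in row 0 only blanks follow the first blank
    after the input, so the certificate has no gaps; the other clauses describe one step, tape by
    tape according to its move. *)
Definition good2 (z : seq bool) (T t p : nat) (d : content)
    (t' p' : nat) (d' : content) : bool :=
  let c := T.+1 in
  [&& (t == t') ==> (d.1 == d'.1),
      [&& t == 0, t' == 0, c + size z <= p, p < p' & d.2 == io_vector None] ==>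
        (d'.2 == io_vector None),
      (t' == t.+1) ==> (d'.1.1 == (next d.1.1 d.1.2).1),
      (t' == t.+1) && (p' == p.+1) ==>
        (if p == c then follows Left true d d' else follows Left false d d'),
      (t' == t.+1) && (p' == p) ==>
        (if p == c then follows Stay true d d' else follows Stay false d d')
    & (t' == t.+1) && (p == p'.+1) ==>
        (if p == c then follows Right true d d' else follows Right false d d')].

Definition content_of (c : nat) (cf : config M) (p : nat) : content :=
  (cf.1, reads_of cf.2, [ffun i => cell_at c (cf.2 i) p]).

(** The head column [T.+1] is in the middle; after [T] steps the border has reached neither it nor
    [T.+2], the two columns that decide the output. *)
Definition width (T : nat) := (2 * T.+1).+1.

Lemma bits_true (r : seq (option (bool + tm_aux M))) : bits_of_cells r = [:: true] <->
  nth None r 0 = Some (inl true) /\ ~~ is_bit (nth None r 1).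
Proof.
case: r => [|[[[]|a]|] [|[[b|a']|] r]] /=; split=> //; by [case|move=> []].
Qed.

Lemma follows_run x c t p p' m : shifts m p p' ->
  follows m (p == c) (content_of c (run x t) p) (content_of c (run x t.+1) p').
Proof.
move=> sh; apply/forallP => i; apply/implyP => /is_moveP mE; rewrite /= !ffunE.
apply/eqP; rewrite (@runS_cell x t c i p p') ?mE //.
Qed.

Lemma tableau_complete z B T w : size w <= B ->
  bits_of_cells ((run (z ++ w) T).2 (tm_io M)).2 = [:: true] ->
  let sigma t p := content_of T.+1 (run (z ++ w) t) p in
  (forall t p, good1 z B T t p (sigma t p)) /\
  (forall t p t' p', good2 z T t p (sigma t p) t' p' (sigma t' p')).
Proof.
move=> wB /bits_true[out0 out1] sigma; set c := T.+1.
have s0 p : (sigma 0 p).2 = io_vector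
    (if p < c then None else nth None [seq Some (inl b) | b <- z ++ w] (p - c)).
  apply/ffunP => i; rewrite !ffunE /cell_at /= -/c.
  by case: (p < c); case: (i == tm_io M) => //=; rewrite nth_nil.
have headE (t : tape (tm_aux M)) : cell_at c t c = tape_read t.
  by rewrite /cell_at ltnn subnn nth0.
split=> [t p|t p t' p'].
- apply/and5P; split; last (apply/and4P; split); apply/implyP.
  + by move=> /eqP ->; apply/eqP/ffunP => i; rewrite !ffunE headE.
  + by move=> /eqP ->.
  + by move=> /andP[/eqP -> pc]; rewrite s0 pc.
  + move=> /andP[/andP[/eqP -> pc] pz]; rewrite s0 ltnNge pc /= map_cat nth_cat size_map pz.
    by rewrite (nth_map false) //; case: nth.
  + move=> /andP[/eqP -> pz]; rewrite s0 (_ : (p < c) = false); last by lia.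
    case: (ltnP (p - c) (size (z ++ w))) => pl; last first.
      by rewrite nth_default ?size_map // eqxx.
    by rewrite (nth_map false) //; case: nth; rewrite eqxx ?orbT.
  + move=> /andP[/eqP -> pz]; rewrite s0 (_ : (p < c) = false); last by lia.
    by rewrite nth_default // size_map size_cat; lia.
  + by move=> /eqP ->; rewrite ffunE /tape_read -nth0 out0.
  + move=> /andP[/eqP -> /eqP ->]; rewrite ffunE /cell_at.
    by rewrite (_ : (_ < _) = false); [rewrite subSnn|lia].
- apply/and5P; split; last (apply/andP; split); apply/implyP.
  + by move=> /eqP ->.
  + case/and5P => /eqP -> /eqP -> pz pp; rewrite !s0.
    rewrite (_ : (p < c) = false); last by lia.
    rewrite (_ : (p' < c) = false); last by lia.
    case: (ltnP (p' - c) (size (z ++ w))) => pl; last first.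
      by move=> _; rewrite nth_default ?size_map.
    rewrite (nth_map false); last by lia.
    by move=> /eqP/ffunP/(_ (tm_io M)); rewrite !ffunE eqxx.
  + by move=> /eqP ->; apply/eqP; exact: runS_state.
  + move=> /andP[/eqP -> sh]; have := @follows_run (z ++ w) c t p p' Left sh.
    by case: (p == c).
  + move=> /andP[/eqP -> sh]; have := @follows_run (z ++ w) c t p p' Stay sh.
    by case: (p == c).
  + move=> /andP[/eqP -> sh]; have := @follows_run (z ++ w) c t p p' Right sh.
    by case: (p == c).
Qed.

(** The certificate is read off row 0. By induction on time, the grid then agrees with the run on a
    range of columns that shrinks by one on each side per step. *)
Lemma tableau_sound z B T (sigma : nat -> nat -> content) :
  (forall t p, t <= T -> p < width T -> good1 z B T t p (sigma t p)) ->
  (forall t p t' p', t <= T -> p < width T -> t' <= T -> p' < width T ->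
     (t, p) <> (t', p') -> good2 z T t p (sigma t p) t' p' (sigma t' p')) ->
  exists2 w, size w <= B
    & bits_of_cells ((run (z ++ w) T).2 (tm_io M)).2 = [:: true].
Proof.
rewrite /width => G1 G2; set c := T.+1.
(* The symbols after the input; the certificate ends at the first blank or after [B] cells. *)
pose h r := (sigma 0 (c + size z + r)).2 (tm_io M).
pose len := find (fun r => h r == None) (iota 0 B).
pose w := mkseq (fun r => h r == Some (inl true)) len.
have lenB : len <= B by rewrite -[X in _ <= X](size_iota 0); exact: find_size.
exists w; first by rewrite size_mkseq.
have hP r : c + size z + r < width T ->
    (sigma 0 (c + size z + r)).2 = io_vector (h r) /\
    [|| h r == None, h r == Some (inl true) | h r == Some (inl false)].
  move=> rW; have /and5P[_ _ _ _ /and4P[/implyP G _ _ _]] := G1 0 _ (leq0n _) rW.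
  have /or3P G' := G ltac:(lia).
  by rewrite /h; case: G' => /eqP ->; rewrite ffunE eqxx ?orbT.
have wP r : c + size z + r < width T ->
    (sigma 0 (c + size z + r)).2 = io_vector (nth None [seq Some (inl b) | b <- w] r).
  move=> rW; have [-> hr] := hP r rW; congr io_vector.
  case: (ltnP r len) => rl.
    rewrite (nth_map false) ?size_mkseq // nth_mkseq //.
    have := before_find 0 rl; rewrite nth_iota ?add0n; last by lia.
    by move: hr; case/or3P => /eqP ->.
  rewrite nth_default ?size_map ?size_iota //.
  have [lB|Bl] := ltnP len B; last first.
    have /and5P[_ _ _ _ /and4P[_ /implyP G _ _]] := G1 0 _ (leq0n _) rW.
    have /eqP G' := G ltac:(lia).
    by rewrite /h G' ffunE eqxx.
  have hl : h len = None.
    have hs : has (fun r => h r == None) (iota 0 B) by rewrite has_find size_iota.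
    by have := nth_find 0 hs; rewrite nth_iota ?add0n // => /eqP.
  case: (ltngtP r len) rl => // [lr _|-> //].
  have lW : c + size z + len < width T by lia.
  have ne : (0, c + size z + len) <> (0, c + size z + r) by case; lia.
  have /and5P[_ /implyP G _ _ /andP[_ _]] := G2 _ _ _ _ (leq0n T) lW (leq0n T) rW ne.
  have /eqP G' : (sigma 0 (c + size z + r)).2 == io_vector None.
    by apply: G; rewrite (hP _ lW).1 hl eqxx; apply/and5P; split=> //; lia.
  by rewrite /h G' ffunE eqxx.
have headE (t : tape (tm_aux M)) : cell_at c t c = tape_read t.
  by rewrite /cell_at ltnn subnn nth0.
have cW : c < width T by rewrite /width /c; lia.
pose x := z ++ w.
(* Only the part of the row that has not been reached from the free border. *)
pose row t := forall p, t <= p -> p + t < width T -> sigma t p = content_of c (run x t) p.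
(* The head column turns its own symbols into the scanned ones, and the other cells of the row copy
   them. *)
have rowI t : t <= T -> (sigma t c).1.1 = (run x t).1 ->
    (forall p, t <= p -> p + t < width T ->
       (sigma t p).2 = [ffun i => cell_at c ((run x t).2 i) p]) -> row t.
  move=> tT st cl p tp pt.
  have cE : (sigma t c).1 = ((run x t).1, reads_of (run x t).2).
    have /and5P[/implyP/(_ (eqxx _))/eqP G _ _ _ /and4P[_ _ _ _]] := G1 t c tT cW.
    rewrite [LHS]surjective_pairing st G cl; [|rewrite /c; lia|rewrite /width /c; lia].
    by congr pair; apply/ffunP => i; rewrite !ffunE headE.
  have pW : p < width T by lia.
  rewrite [LHS]surjective_pairing cl // /content_of; congr pair.
  have [->//|pc] := eqVneq p c.
  have ne : (t, p) <> (t, c) by case => /eqP; rewrite (negPf pc).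
  have /and5P[/implyP/(_ (eqxx _))/eqP -> _ _ _ /andP[_ _]] := G2 _ _ _ _ tT pW tT cW ne.
  exact: cE.
have rows t : t <= T -> row t.
  elim: t => [_|t IH tT].
    apply: rowI => //.
      by have /and5P[_ /implyP/(_ isT)/eqP -> _ _ _] := G1 0 c (leq0n _) cW.
    move=> p _; rewrite addn0 => pW.
    have -> : [ffun i => cell_at c ((run x 0).2 i) p] = io_vector
        (if p < c then None else nth None [seq Some (inl b) | b <- x] (p - c)).
      apply/ffunP => i; rewrite !ffunE /cell_at /=.
      by case: (p < c); case: (i == tm_io M) => //=; rewrite nth_nil.
    have /and5P[_ _ /implyP Gl /implyP Gz /and4P[_ _ _ _]] := G1 0 p (leq0n _) pW.
    case: (ltnP p c) => pc; first by apply/eqP/Gl; rewrite pc.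
    rewrite /x map_cat nth_cat size_map; case: ltnP => pz.
      rewrite (nth_map false) //.
      by have := Gz ltac:(lia); case: nth => /eqP.
    have pE : p = c + size z + (p - c - size z) by lia.
    by rewrite [in LHS]pE wP // -pE.
  have {}IH := IH (ltnW tT).
  have tT' := ltnW tT.
  apply: rowI => //.
    have ne : (t, c) <> (t.+1, c) by case; lia.
    have /and5P[_ _ /implyP/(_ (eqxx _))/eqP -> _ /andP[_ _]] := G2 _ _ _ _ tT' cW tT cW ne.
    by rewrite IH /= ?runS_state //; rewrite /c /width; lia.
  move=> p tp pt; apply/ffunP => i; rewrite ffunE.
  have pW : p < width T by lia.
  (* On tape [i] the symbol at [p] comes from the neighbour [q] selected by the move of that
     tape. *)
  have fol m q : shifts m q p -> t <= q -> q + t < width T ->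
      ((next (run x t).1 (reads_of (run x t).2)).2 i).2 = m ->
      (sigma t.+1 p).2 i = cell_at c ((run x t.+1).2 i) p.
    move=> sh tq qt mE; have qW : q < width T by lia.
    have ne : (t, q) <> (t.+1, p) by case; lia.
    rewrite (@runS_cell x t c i q p) ?mE //.
    have /and5P[_ _ _ /implyP Gl /andP[/implyP Gs /implyP Gr]] := G2 _ _ _ _ tT' qW tT pW ne.
    have /forallP/(_ i) : follows m (q == c) (sigma t q) (sigma t.+1 p).
      case: m sh mE => /= sh _; [have := Gl|have := Gs|have := Gr].
      - by rewrite eqxx sh /= => /(_ isT); case: (q == c).
      - by rewrite eqxx sh /= => /(_ isT); case: (q == c).
      - by rewrite eqxx sh /= => /(_ isT); case: (q == c).
    by rewrite (IH q tq qt) /= mE ffunE; case: m {sh mE} => /= /eqP.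
  case mE: ((next (run x t).1 (reads_of (run x t).2)).2 i).2.
  - by apply: (fol Left p.-1) => //=; first apply/eqP; lia.
  - by apply: (fol Stay p) => //=; lia.
  - by apply: (fol Right p.+1) => //=; lia.
have c1W : c.+1 < width T by rewrite /width /c; lia.
apply/bits_true; split.
  have /and5P[_ _ _ _ /and4P[_ _ /implyP/(_ (eqxx _))/eqP G _]] := G1 T c (leqnn _) cW.
  rewrite rows in G; [|by []|by rewrite /c|by rewrite /c /width; lia].
  by rewrite /= ffunE /tape_read -nth0 in G.
have /and5P[_ _ _ _ /and4P[_ _ _ /implyP G]] := G1 T c.+1 (leqnn _) c1W.
rewrite !eqxx rows in G; [|by []|by rewrite /c; lia|by rewrite /c /width; lia].
have := G isT; rewrite /= ffunE /cell_at (_ : (c.+1 < c) = false); last by lia.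
by rewrite subSnn.
Qed.

End Tableau.

(** * Definability of the reduction *)

Lemma num_ifb (b b1 b2 : environment -> bool) :
  num_def (fun env => b env) -> num_def (fun env => b1 env) ->
  num_def (fun env => b2 env) ->
  num_def (fun env => if b env then b1 env else b2 env).
Proof.
move=> P P1 P2; apply: num_ext (num_if P P1 P2) => env; by case: (b env).
Qed.

(** The list does not depend on the environment, so a lookup is a fixed finite case distinction.
    This handles cell contents, whose number depends only on the machine. *)
Lemma num_table (D : Type) (d0 : D) (l : seq D) (F : D -> environment -> nat) J :
  (forall d, num_def (F d)) -> num_def J ->
  num_def (fun env => F (nth d0 l (J env)) env).
Proof.
move=> FP; elim: l J => [|a l IH] J JP.
  by apply: num_ext (FP d0) => env; rewrite nth_nil.
have P := num_if (num_eq JP (num_const 0)) (FP a) (IH _ (num_sub JP (num_const 1))).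
by apply: num_ext P => env; case: (J env) => [|j] //=; rewrite subn1.
Qed.

Ltac num_tac := repeat first
  [ assumption
  | apply: num_const
  | apply: num_succ
  | apply: num_add
  | apply: num_mul
  | apply: num_exp
  | apply: num_sub
  | apply: num_div
  | apply: num_mod
  | apply: num_imply
  | apply: num_and
  | apply: num_or
  | apply: num_neg
  | apply: num_ifb
  | apply: num_nth
  | apply: num_eq
  | apply: num_leq
  | apply: num_size
  | apply: str_var ].

Section Definability.
Variable M : TM.

Lemma num_good1 Z B T t p (d : content M) :
  str_def Z -> num_def B -> num_def T -> num_def t -> num_def p ->
  num_def (fun env => good1 (Z env) (B env) (T env) (t env) (p env) d).
Proof. by move=> ? ? ? ? ?; rewrite /good1; num_tac. Qed.

Lemma num_good2 Z T t p t' p' (d d' : content M) :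
  str_def Z -> num_def T -> num_def t -> num_def p -> num_def t' -> num_def p' ->
  num_def (fun env => good2 (Z env) (T env) (t env) (p env) d (t' env) (p' env) d').
Proof. by move=> ? ? ? ? ? ?; rewrite /good2; num_tac. Qed.

End Definability.

Lemma str_encode_seq v F (P : environment -> nat -> bool)
    (enc : environment -> nat -> seq bool) :
  (forall env s i, P (upd env v s) i = P env i) ->
  (forall env s i, enc (upd env v s) i = enc env i) ->
  num_def F -> num_def (fun env => P env (size (env v))) ->
  str_def (fun env => enc env (size (env v))) ->
  str_def (fun env => encode_seq (enc env) [seq i <- iota 0 (F env) | P env i]).
Proof.
move=> Pv encv FP PP encP.
pose H env i := if P env i then true :: enc env i else [::].
apply: (@str_ext (fun env => flatten [seq H env i | i <- iota 0 (F env)] ++ [:: false])).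
  move=> env; rewrite /encode_seq; congr (_ ++ _); rewrite /H.
  by elim: (iota 0 _) => //= i l ->; case: (P env i).
apply: str_cat; last exact: str_lit.
apply: (@str_for v) => //; first by move=> env s i; rewrite /H Pv encv.
by apply: str_if => //; [apply: (str_cat (str_lit [:: true]))|exact: str_lit].
Qed.

Lemma encode_seq_map (S T : Type) (enc : T -> seq bool) (F : S -> T) s :
  encode_seq enc [seq F i | i <- s] = encode_seq (fun i => enc (F i)) s.
Proof. by rewrite /encode_seq -map_comp. Qed.

Lemma str_encode_map v F (enc : environment -> nat -> seq bool) :
  (forall env s i, enc (upd env v s) i = enc env i) -> num_def F ->
  str_def (fun env => enc env (size (env v))) ->
  str_def (fun env => encode_seq (enc env) (iota 0 (F env))).
Proof.
move=> encv FP encP.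
apply: (@str_ext (fun env => encode_seq (enc env) [seq i <- iota 0 (F env) | true])).
  by move=> env; rewrite filter_predT.
by apply: (@str_encode_seq v _ (fun _ _ => true)) => //; exact: num_const.
Qed.

Lemma str_encode_bits : str_def (fun env => encode_bits (env 0)).
Proof.
pose H (env : environment) i := [:: nth false (env 0) i].
apply: (@str_ext (fun env => encode_seq (H env) (iota 0 (size (env 0))))).
  move=> env; rewrite /encode_bits.
  by rewrite -[in RHS](mkseq_nth false (env 0)) /mkseq encode_seq_map.
apply: (@str_encode_map 1 _ H) => //; first exact: num_size (str_var 0).
apply: (@str_ext (fun env => if nth false (env 0) (size (env 1)) then [:: true] else [:: false])).
  by move=> env; rewrite /H; case: nth.
apply: str_if; try exact: str_lit.
by apply: num_nth; [exact: str_var|exact: num_size (str_var 1)].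
Qed.

(** Variable 0 is the input, and the lengths of variables 1 and 2 are an agent and a program. *)
Lemma str_sorted_instance (na np : seq bool -> nat)
    (adj : seq bool -> nat -> nat -> bool) (cost : seq bool -> nat -> nat) :
  num_def (fun env => na (env 0)) -> num_def (fun env => np (env 0)) ->
  num_def (fun env => adj (env 0) (size (env 1)) (size (env 2))) ->
  num_def (fun env => cost (env 0) (size (env 1))) ->
  str_def (fun env => encode_instance
    (sorted_instance (na (env 0)) (np (env 0)) (adj (env 0)) (cost (env 0)))).
Proof.
move=> naP npP adjP costP.
apply: str_ext (fun env => esym (encode_sorted_instance _ _ _ _)) _.
have V u : num_def (fun env => size (env u)) by exact: num_size (str_var u).
have N u : str_def (fun env => encode_nat (size (env u))) by apply: str_nat.
apply: str_cat; last apply: str_cat.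
- apply: str_ext (fun env => esym (encode_seq_map _ _ _)) _.
  apply: (@str_encode_map 1 _ (fun env a => encode_seq encode_nat
    [seq p <- iota 0 (np (env 0)) | adj (env 0) a p])) => //.
  by apply: (@str_encode_seq 2 _ (fun env p => adj (env 0) (size (env 1)) p) (fun _ => encode_nat)).
- apply: str_ext (fun env => esym (encode_seq_map _ _ _)) _.
  apply: (@str_encode_map 2 _ (fun env p => encode_seq encode_nat
    [seq a <- iota 0 (na (env 0)) | adj (env 0) a p])) => //.
  by apply: (@str_encode_seq 1 _ (fun env a => adj (env 0) a (size (env 2))) (fun _ => encode_nat)).
- apply: str_ext (fun env => esym (encode_seq_map _ _ _)) _.
  apply: (@str_encode_map 1 _ (fun env p => encode_nat (cost (env 0) p))) => //.
  exact: str_nat.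
Qed.

(** * The reduction from a language in NP *)

Section CookLevin.
Variables (M : TM) (V : seq bool -> seq bool) (k d kV dV g : nat).
Hypothesis MV : forall y, exists2 t, t <= kV * size y ^ dV + kV & halts_with M y t (V y).

Definition bound (x : seq bool) := k * size x ^ d + k.
Definition input x := encode_bits x.
(** A time by which the verifier has halted on every certificate of length at most [bound x]. *)
Definition time x := kV * (size (input x) + bound x) ^ dV + kV.
Definition content0 : content M :=
  (tm_start M, [ffun=> None], [ffun=> None]).
Definition contents := #|{: content M}|.
Definition decode (j : nat) : content M := nth content0 (enum {: content M}) j.
Definition cells x := (time x).+1 * width (time x).
Definition vertices x := cells x * contents.

Definition vertex_time x u := u %/ contents %/ width (time x).
Definition vertex_pos x u := u %/ contents %% width (time x).
Definition vertex_content u := decode (u %% contents).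

Definition local_ok x u :=
  good1 (input x) (bound x) (time x) (vertex_time x u) (vertex_pos x u)
    (vertex_content u).
Definition pair_ok x u v :=
  good2 (input x) (time x) (vertex_time x u) (vertex_pos x u) (vertex_content u)
    (vertex_time x v) (vertex_pos x v) (vertex_content v).

(** A vertex whose content is wrong for its cell conflicts with all vertices, so it is never chosen
    together with another one. Pairs are tested in both orders because only [u < v] is ever
    asked. *)
Definition conflict x u v : bool :=
  (u %/ contents == v %/ contents) ||
  ~~ [&& local_ok x u, local_ok x v, pair_ok x u v & pair_ok x v u].

Lemma contents_gt0 : 0 < contents.
Proof. by apply/card_gt0P; exists content0. Qed.

Definition code (c : content M) : nat := index c (enum {: content M}).

Lemma code_lt c : code c < contents.
Proof. by rewrite /contents cardE index_mem mem_enum. Qed.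

Lemma codeK c : decode (code c) = c.
Proof. by rewrite /decode nth_index ?mem_enum. Qed.

Lemma run_accepts x w : size w <= bound x ->
  V (input x ++ w) = bits_of_cells ((run M (input x ++ w) (time x)).2 (tm_io M)).2.
Proof.
move=> wB; have [t tl /halts_run H] := MV (input x ++ w).
rewrite H //; apply: leq_trans tl _; rewrite /time leq_add2r leq_mul2l.
apply/orP; right; case: dV => [|e]; first by rewrite !expn0.
by rewrite leq_exp2r // size_cat leq_add2l.
Qed.

Lemma accepts_assignment x :
  (exists2 w, size w <= bound x & V (input x ++ w) = [:: true]) <->
  (exists2 tau : nat -> nat, forall c, c < cells x -> tau c < contents
     & forall c c', c < c' -> c' < cells x ->
         ~~ conflict x (c * contents + tau c) (c' * contents + tau c')).
Proof.
set W := width (time x); have W0 : 0 < W by [].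
have W2 : 2 < W by rewrite /W /width; lia.
split=> [[w wB acc]|[tau tauD tauP]].
- rewrite run_accepts // in acc.
  pose sigma t p := content_of (time x).+1 (run M (input x ++ w) t) p.
  have [G1 G2] := tableau_complete wB acc; rewrite -/sigma in G1 G2.
  pose tau c := code (sigma (c %/ W) (c %% W)).
  have tauD c : tau c < contents by exact: code_lt.
  have tauE c : [/\ (c * contents + tau c) %/ contents = c,
      vertex_time x (c * contents + tau c) = c %/ W, vertex_pos x (c * contents + tau c) = c %% W
      & vertex_content (c * contents + tau c) = sigma (c %/ W) (c %% W)].
    rewrite /vertex_time /vertex_pos /vertex_content divnMDl ?contents_gt0 //.
    rewrite (divn_small (tauD c)) addn0 modnMDl (modn_small (tauD c)); split=> //.
    exact: codeK.
  exists tau => // c c' cc' _; have [q1 t1 p1 d1] := tauE c; have [q2 t2 p2 d2] := tauE c'.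
  rewrite /conflict q1 q2 negb_or negbK (ltn_eqF cc') /=.
  by rewrite /local_ok /pair_ok t1 t2 p1 p2 d1 d2 !G1 !G2.
pose sigma t p := decode (tau (t * W + p)).
have cellL t p : t <= time x -> p < W -> t * W + p < cells x.
  by move=> tT pW; rewrite /cells -/W; nia.
have cellE t p : t <= time x -> p < W -> let u := (t * W + p) * contents + tau (t * W + p) in
    [/\ vertex_time x u = t, vertex_pos x u = p & vertex_content u = sigma t p].
  move=> tT pW /=; have tD := tauD _ (cellL t p tT pW).
  rewrite /vertex_time /vertex_pos /vertex_content divnMDl ?contents_gt0 //.
  rewrite (divn_small tD) addn0 modnMDl (modn_small tD) -/W.
  by rewrite divnMDl // (divn_small pW) addn0 modnMDl (modn_small pW).
have ok t p t' p' : t <= time x -> p < W -> t' <= time x -> p' < W ->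
    (t, p) <> (t', p') ->
    [/\ good1 (input x) (bound x) (time x) t p (sigma t p),
        good2 (input x) (time x) t p (sigma t p) t' p' (sigma t' p')
      & good2 (input x) (time x) t' p' (sigma t' p') t p (sigma t p)].
  move=> tT pW tT' pW' ne.
  have [t1 p1 d1] := cellE t p tT pW; have [t2 p2 d2] := cellE t' p' tT' pW'.
  have l1 := cellL t p tT pW; have l2 := cellL t' p' tT' pW'.
  have neq : t * W + p <> t' * W + p'.
    move=> E; apply: ne; congr pair.
      by have := congr1 (divn^~ W) E; rewrite !divnMDl // !divn_small // !addn0.
    by have := congr1 (modn^~ W) E; rewrite !modnMDl !modn_small.
  case: (ltngtP (t * W + p) (t' * W + p')) => // lt.
    have := tauP _ _ lt l2; rewrite /conflict negb_or negbK => /andP[_ /and4P[]].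
    by rewrite /local_ok /pair_ok t1 t2 p1 p2 d1 d2.
  have := tauP _ _ lt l1; rewrite /conflict negb_or negbK => /andP[_ /and4P[]].
  by rewrite /local_ok /pair_ok t1 t2 p1 p2 d1 d2.
have [] := @tableau_sound M (input x) (bound x) (time x) sigma.
- move=> t p tT pW.
  (* Local conditions are visible only in conflicts, so a second cell of the row is needed: column 1
     if [p] is 0, and column 0 otherwise. *)
  have pW' : (p == 0 : nat) < W by case: (p == 0); lia.
  have ne : (t, p) <> (t, p == 0 : nat) by case; case: p {pW pW'}.
  by have [] := ok _ _ _ _ tT pW tT pW' ne.
- by move=> t p t' p' tT pW tT' pW' ne; have [] := ok t p t' p' tT pW tT' pW' ne.
by move=> w wB acc; exists w => //; rewrite run_accepts.
Qed.

Definition reduction x : instance := conflict_instance (vertices x) g (conflict x).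
Definition budget x := vertices x * vertices x + (vertices x - cells x).

Lemma reduction_correct x :
  (exists2 w, size w <= bound x & V (input x ++ w) = [:: true]) <->
  (exists2 s : mp_solution (m := min_sum) (reduction x), optimal s & mp_cost s <= budget x).
Proof.
have cells0 : 0 < cells x by rewrite /cells muln_gt0.
have le : cells x <= vertices x by rewrite leq_pmulr ?contents_gt0.
rewrite accepts_assignment -selection_assignment ?contents_gt0 //; last first.
  by move=> u v _ uv; rewrite /conflict uv eqxx.
rewrite -(@conflict_correct (vertices x) g (conflict x) (cells x)) ?cells0 //.
rewrite -assignment_nat; symmetry; exact: optimal_exists.
Qed.

Lemma str_reduction :
  str_def (fun env => encode_instance (reduction (env 0)) ++ encode_nat (budget (env 0))).
Proof.
have Z : str_def (fun env => input (env 0)) := str_encode_bits.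
have B : num_def (fun env => bound (env 0)) by rewrite /bound; num_tac.
have T : num_def (fun env => time (env 0)) by rewrite /time; num_tac.
have W : num_def (fun env => width (time (env 0))) by rewrite /width; num_tac.
have C : num_def (fun env => cells (env 0)) by rewrite /cells; num_tac.
have N : num_def (fun env => vertices (env 0)) by rewrite /vertices; num_tac.
have Tm u : num_def u -> num_def (fun env => vertex_time (env 0) (u env)).
  by move=> uP; rewrite /vertex_time; num_tac.
have Ps u : num_def u -> num_def (fun env => vertex_pos (env 0) (u env)).
  by move=> uP; rewrite /vertex_pos; num_tac.
have L1 u : num_def u -> num_def (fun env => local_ok (env 0) (u env)).
  move=> uP; rewrite /local_ok.
  apply: (@num_table _ content0 _ (fun c env => good1 (input (env 0)) (bound (env 0))
     (time (env 0)) (vertex_time (env 0) (u env)) (vertex_pos (env 0) (u env)) c)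
     (fun env => u env %% contents)); last by num_tac.
  by move=> c; apply: num_good1 => //; [exact: Tm|exact: Ps].
have L2 u v : num_def u -> num_def v ->
    num_def (fun env => pair_ok (env 0) (u env) (v env)).
  move=> uP vP; rewrite /pair_ok.
  apply: (@num_table _ content0 _ (fun c env => good2 (input (env 0))
     (time (env 0)) (vertex_time (env 0) (u env)) (vertex_pos (env 0) (u env)) c
     (vertex_time (env 0) (v env)) (vertex_pos (env 0) (v env)) (vertex_content (v env)))
     (fun env => u env %% contents)); last by num_tac.
  move=> c; apply: (@num_table _ content0 _ (fun c' env => good2 (input (env 0))
     (time (env 0)) (vertex_time (env 0) (u env)) (vertex_pos (env 0) (u env)) c
     (vertex_time (env 0) (v env)) (vertex_pos (env 0) (v env)) c')
     (fun env => v env %% contents)); last by num_tac.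
  by move=> c'; apply: num_good2 => //; (exact: Tm || exact: Ps).
have Cf u v : num_def u -> num_def v ->
    num_def (fun env => conflict (env 0) (u env) (v env)).
  move=> uP vP; rewrite /conflict; apply: num_or; first by num_tac.
  apply: num_neg; apply: num_and; first exact: L1.
  by apply: num_and; [exact: L1|apply: num_and; exact: L2].
apply: str_cat; last by apply: str_nat; rewrite /budget; num_tac.
apply: (@str_sorted_instance (fun x => num_agent (vertices x)) (fun x => num_program (vertices x) g)
  (fun x => adjacent (vertices x) g (conflict x)) (fun x => cost (vertices x) g)).
- by rewrite /num_agent; num_tac.
- by rewrite /num_program; num_tac.
- rewrite /adjacent; apply: num_ifb; first by num_tac.
    by num_tac.
  apply: num_ifb; [by num_tac|by num_tac|].
  apply: num_ifb; [|by num_tac|by num_tac].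
  apply: num_and; first by num_tac.
  by apply: Cf; num_tac.
- by rewrite /cost; num_tac.
Qed.

End CookLevin.

Theorem theorem2 (f : nat) (hf : 2 <= f) :
  @NP_hard_on min_sum (restricted f).
Proof.
(* Here [f = g.+2]: a conflicting pair lists two ends, and [g] padding programs fill its list up. *)
case: f hf => [|[|g]] // _ L [V [k [d [[M [kV [dV MV]]] LV]]]].
have [e eE] := str_reduction M k d kV dV g.
exists (fun x => eval (upd (fun=> [::]) 0 x) e); first exact: eval_polytime.
move=> x; exists (reduction M k d kV dV g x), (budget M k d kV dV x); split.
- by rewrite eE.
- apply: conflict_restricted.
  by rewrite /vertices /cells !muln_gt0 contents_gt0.
- rewrite LV; exact: (reduction_correct k d g MV x).
Qed.
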